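(* Let $X\subseteq\mathbb R^d$, $Y\subseteq\mathbb R^n$ be closed convex sets and $f:X\times Y\to\mathbb R$ continuous, with $f(\cdot,y)$ $\mu$-strongly convex on $X$ for every $y\in Y$ and $f(x,\cdot)$ $\lambda$-strongly concave on $Y$ for every $x\in X$. Suppose there exist $B_1,B_2>0$ such that the stochastic subgradients $\mathcal G_x,\mathcal G_y$ of $f$ satisfy $\mathbb E[\exp(\|\mathcal G_x\|^2/B_1^2)]\le \exp(1)$ and $\mathbb E[\exp(\|\mathcal G_y\|^2/B_2^2)]\le\exp(1)$. Suppose there exist initial solutions $x_0\in X$, $y_0\in Y$ and $\epsilon_0>0$ such that $\mathrm{Gap}(x_0,y_0)\le\epsilon_0$. Let $\delta\in(0,1)$ be a failing probability and $\epsilon\in(0,1)$ the target accuracy level for the duality gap. Let $K=\lceil\log_2(\epsilon_0/\epsilon)\rceil$ and $\tilde\delta=\delta/K$, and let the initial parameters be set by $$R_1\ge 2\sqrt{\frac{2\epsilon_0}{\min\{\mu,\lambda\}}},\qquad \eta_x^1=\frac{\min\{\mu,\lambda\}R_1^2}{40(5+3\log(1/\tilde\delta))B_1^2},\qquad \eta_y^1=\frac{\min\{\mu,\lambda\}R_1^2}{40(5+3\log(1/\tilde\delta))B_2^2},$$ $$T_1\ \ge\ \frac{\max\{320^2(B_1+B_2)^2\,3\log(1/\tilde\delta),\ 3200(5+3\log(1/\tilde\delta))\max\{B_1^2,B_2^2\}\}}{\min\{\mu,\lambda\}^2R_1^2}.$$ Then the total number of iterations of Epoch-GDA (described in the context)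 to achieve an $\epsilon$-duality gap, i.e. $\mathrm{Gap}(\bar x_K,\bar y_K)\le\epsilon$, with probability $1-\delta$ is $$T_{tot}=\frac{\max\{320^2(B_1+B_2)^2\,3\log(1/\tilde\delta),\ 3200(5+3\log(1/\tilde\delta))\max\{B_1^2,B_2^2\}\}}{4\min\{\mu,\lambda\}\,\epsilon}.$$
   Context: $\|\cdot\|$ is the Euclidean norm; $\Pi_\Omega$ is Euclidean projection onto $\Omega$; $\mathcal B(x,R)$ is the Euclidean ball with center $x$ and radius $R$; $\log$ without a base is the natural logarithm. Duality gap: $\mathrm{Gap}(x,y)=\max_{y'\in Y}f(x,y')-\min_{x'\in X}f(x',y)$. A function $h$ is $\mu$-strongly convex on $X$ ($\mu>0$) if $v^\top(x-x')+\frac\mu2\|x-x'\|^2\le h(x)-h(x')$ for all $x,x'\in X$ and all $v\in\partial h(x')$; $h$ is $\lambda$-strongly concave ($\lambda>0$) if $-h$ is $\lambda$-strongly convex. Stochastic oracle: at $(x,y)\in X\times Y$ it returns $\mathcal G_x=\partial_xf(x,y;\xi)$ and $\mathcal G_y=\partial_yf(x,y;\xi)$, stochastic subgradients of $f$ in $x$ (given $y$) and in $y$ (given $x$), where $\xi$ is a random variable; $\mathbb E[\mathcal G_x]$ is a subgradient of $f(\cdot,y)$ at $x$ and $\mathbb E[\mathcal G_y]$ is a supergradient of $f(x,\cdot)$ at $y$. The samples $\xi_t^k$ used by the algorithm are fresh (independent of the past), so these properties and the exponential moment bounds hold conditionally on the past. Epoch-GDA: $x_0^1=x_0$, $y_0^1=y_0$,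 with initial parameters $\eta_x^1,\eta_y^1,R_1,T_1$. For $k=1,\dots,K$: for $t=0,\dots,T_k-1$ compute $\mathcal G_{x,t}^k=\partial_xf(x_t^k,y_t^k;\xi_t^k)$, $\mathcal G_{y,t}^k=\partial_yf(x_t^k,y_t^k;\xi_t^k)$ and set $$x_{t+1}^k=\Pi_{X\cap\mathcal B(x_0^k,R_k)}(x_t^k-\eta_x^k\mathcal G_{x,t}^k),\qquad y_{t+1}^k=\Pi_{Y\cap\mathcal B(y_0^k,R_k)}(y_t^k+\eta_y^k\mathcal G_{y,t}^k).$$ Then put $x_0^{k+1}=\bar x_k=\frac1{T_k}\sum_{t=0}^{T_k-1}x_t^k$, $y_0^{k+1}=\bar y_k=\frac1{T_k}\sum_{t=0}^{T_k-1}y_t^k$, and $\eta_x^{k+1}=\eta_x^k/2$, $\eta_y^{k+1}=\eta_y^k/2$, $R_{k+1}=R_k/\sqrt2$, $T_{k+1}=2T_k$. Return $(\bar x_K,\bar y_K)$. The total number of iterations is $\sum_{k=1}^K T_k$.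
   Formalization: Gap ≤ ε is claimed when R_1 equals its stated bound; for larger R_1 (where the claim can fail) the gap is ≤ (min{μ,λ}R_1²/(8ε_0))ε. The total is not equal to T_tot but at most T_tot plus (T_1 − its threshold)(2^K − 1). K is taken to be nonnegative. *)

(* Defs.v *)
From HB Require Import structures.
From mathcomp Require Import all_boot all_order all_algebra finmap.
From mathcomp Require Import all_classical all_reals all_analysis.

Set Implicit Arguments.
Unset Strict Implicit.
Unset Printing Implicit Defensive.

Import Order.TTheory GRing.Theory Num.Theory.
Import numFieldNormedType.Exports.

Local Open Scope classical_set_scope.
Local Open Scope ring_scope.

Section Euclidean.
Context {R : realType} {d : nat}.
Implicit Types (u v x : 'rV[R]_d) (C : set 'rV[R]_d).

Definition dot u v : R := \sum_(i < d) u ord0 i * v ord0 i.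

(* The library norm [`|x|] on matrices is the sup norm (it induces the same
   topology), hence this separate Euclidean norm. *)
Definition enorm x : R := Num.sqrt (dot x x).

Definition eball x (r : R) : set 'rV[R]_d := [set z | enorm (z - x) <= r].

(* The default value [0] is never used when [C] is nonempty and closed. *)
Definition proj C x : 'rV[R]_d :=
  xget 0 [set p | C p /\ forall q, C q -> enorm (x - p) <= enorm (x - q)].

(* Subdifferential of a function whose domain is [C]; the values of [h] outside
   [C] are irrelevant. *)
Definition subdiff C (h : 'rV[R]_d -> R) x : set 'rV[R]_d :=
  [set v | forall z, C z -> h x + dot v (z - x) <= h z].

Definition superdiff C (h : 'rV[R]_d -> R) x : set 'rV[R]_d :=
  [set v | forall z, C z -> h z <= h x + dot v (z - x)].

(* Convexity of [h] is not asserted separately: it follows as soon as [h] has a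
   subgradient at every point of [C], which [unbiased_oracle] below provides. *)
Definition strongly_convex (mu : R) C (h : 'rV[R]_d -> R) : Prop :=
  forall x x' v, C x -> C x' -> subdiff C h x' v ->
    dot v (x - x') + mu / 2 * enorm (x - x') ^+ 2 <= h x - h x'.

Definition strongly_concave (lambda : R) C (h : 'rV[R]_d -> R) : Prop :=
  strongly_convex lambda C (fun x => - h x).

End Euclidean.

Definition borelRV (R : realType) (d : nat) :=
  g_sigma_algebraType (@open 'rV[R]_d).

(* Extended-real valued so that unbounded sections give [+oo]. *)
Definition gap (R : realType) (d n : nat) (X : set 'rV[R]_d) (Y : set 'rV[R]_n)
    (f : 'rV[R]_d -> 'rV[R]_n -> R) (x : 'rV[R]_d) (y : 'rV[R]_n) : \bar R :=
  (ereal_sup [set (f x y')%:E | y' in Y] -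
   ereal_inf [set (f x' y)%:E | x' in X])%E.

Section Oracle.
Context {R : realType} {d n : nat} {dXi : measure_display}
  {Xi : measurableType dXi}.
Variables (D : probability Xi R) (X : set 'rV[R]_d) (Y : set 'rV[R]_n).

(* Joint measurability lets the oracle be queried at random, past-dependent
   points; for fresh samples the unbiasedness and moment conditions then hold
   conditionally on the past. *)
Definition measurable_oracle (m : nat)
    (G : 'rV[R]_d -> 'rV[R]_n -> Xi -> 'rV[R]_m) : Prop :=
  measurable_fun
    (X `*` Y `*` [set: Xi] : set (borelRV R d * borelRV R n * Xi))
    (fun p => G p.1.1 p.1.2 p.2 : borelRV R m).

Definition mean_vector (m : nat) (g : Xi -> 'rV[R]_m) : 'rV[R]_m :=
  \row_(i < m) (\int[D]_s g s ord0 i)%R.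

Definition unbiased_oracle (f : 'rV[R]_d -> 'rV[R]_n -> R)
    (Gx : 'rV[R]_d -> 'rV[R]_n -> Xi -> 'rV[R]_d)
    (Gy : 'rV[R]_d -> 'rV[R]_n -> Xi -> 'rV[R]_n) : Prop :=
  forall x y, X x -> Y y ->
    subdiff X (f^~ y) x (mean_vector (Gx x y)) /\
    superdiff Y (f x) y (mean_vector (Gy x y)).

Definition exp_moment_bound (m : nat)
    (G : 'rV[R]_d -> 'rV[R]_n -> Xi -> 'rV[R]_m) (B : R) : Prop :=
  forall x y, X x -> Y y ->
    (\int[D]_s (expR (enorm (G x y s) ^+ 2 / B ^+ 2))%:E <= (expR 1)%:E)%E.

End Oracle.

Definition mutually_independent (R : realType) (dO dXi : measure_display)
    (Omega : measurableType dO) (Xi : measurableType dXi)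
    (P : probability Omega R) (I : choiceType)
    (Z : I -> {RV P >-> Xi}) : Prop :=
  forall (J : {fset I}) (A : I -> set Xi), (forall i, measurable (A i)) ->
    P (\bigcap_(i in [set` J]) (Z i @^-1` A i)) =
    (\prod_(i <- J) P (Z i @^-1` A i))%E.

(* The samples [xi k t] are fresh draws of the oracle's randomness: each has
   law [D], and each is independent of all the others. *)
Definition fresh_samples (R : realType) (dO dXi : measure_display)
    (Omega : measurableType dO) (Xi : measurableType dXi)
    (P : probability Omega R) (D : probability Xi R)
    (xi : nat -> nat -> {RV P >-> Xi}) : Prop :=
  (forall k t (A : set Xi), measurable A -> P (xi k t @^-1` A) = D A) /\
  mutually_independent (fun kt : nat * nat => xi kt.1 kt.2).

Record epoch_params (R : realType) := EpochParams {
  step_x : R; step_y : R; radius : R; nb_iter : nat }.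

Definition next_params (R : realType) (p : epoch_params R) : epoch_params R :=
  EpochParams (step_x p / 2) (step_y p / 2) (radius p / Num.sqrt 2)
    (2 * nb_iter p)%N.

Section EpochGDA.
Context {R : realType} {d n : nat} {Xi : Type}.
Variables (X : set 'rV[R]_d) (Y : set 'rV[R]_n).
Variables (Gx : 'rV[R]_d -> 'rV[R]_n -> Xi -> 'rV[R]_d)
          (Gy : 'rV[R]_d -> 'rV[R]_n -> Xi -> 'rV[R]_n).

Fixpoint inner_iterate (p : epoch_params R) (z0 : 'rV[R]_d * 'rV[R]_n)
    (s : nat -> Xi) (t : nat) : 'rV[R]_d * 'rV[R]_n :=
  if t is t'.+1 then
    let z := inner_iterate p z0 s t' in
    (proj (X `&` eball z0.1 (radius p))
       (z.1 - step_x p *: Gx z.1 z.2 (s t')),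
     proj (Y `&` eball z0.2 (radius p))
       (z.2 + step_y p *: Gy z.1 z.2 (s t')))
  else z0.

Definition epoch_average (p : epoch_params R) (z0 : 'rV[R]_d * 'rV[R]_n)
    (s : nat -> Xi) : 'rV[R]_d * 'rV[R]_n :=
  ((nb_iter p)%:R^-1 *: \sum_(t < nb_iter p) (inner_iterate p z0 s t).1,
   (nb_iter p)%:R^-1 *: \sum_(t < nb_iter p) (inner_iterate p z0 s t).2).

Variables (p1 : epoch_params R) (z0 : 'rV[R]_d * 'rV[R]_n).

(* Epochs are numbered from 0: [epoch_gda s k] is the pair returned after the
   first [k] epochs, i.e. the initial point of the next one. *)
Fixpoint epoch_gda (s : nat -> nat -> Xi) (k : nat) : 'rV[R]_d * 'rV[R]_n :=
  if k is k'.+1 then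
    epoch_average (iter k' (@next_params R) p1) (epoch_gda s k') (s k')
  else z0.

End EpochGDA.

Definition total_iterations (R : realType) (p1 : epoch_params R) (K : nat)
    : nat :=
  (\sum_(k < K) nb_iter (iter k (@next_params R) p1))%N.

(* The numerator shared by the thresholds on the first epoch length and on the
   total number of iterations; [dt] is the failure probability per epoch. *)
Definition iteration_constant (R : realType) (B1 B2 dt : R) : R :=
  Num.max (320 ^+ 2 * (B1 + B2) ^+ 2 * (3 * ln (1 / dt)))
          (3200 * (5 + 3 * ln (1 / dt)) * Num.max (B1 ^+ 2) (B2 ^+ 2)).

(* Main.v *)
From Pilot Require Import Defs.
From HB Require Import structures.
From mathcomp Require Import all_boot all_order all_algebra finmap.
From mathcomp Require Import all_classical all_reals all_analysis.
From mathcomp Require Import measurable_realfun ring lra.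
Import Pilot.Defs.

Set Implicit Arguments.
Unset Strict Implicit.
Unset Printing Implicit Defensive.

Import Order.TTheory GRing.Theory Num.Theory.
Import numFieldNormedType.Exports.

Local Open Scope classical_set_scope.
Local Open Scope ring_scope.

(** Let [m = min (mu, lambda)] and let [R] be the radius of the current epoch.
    Each epoch halves the bound [m R^2 / 8] on the duality gap of its starting
    point [(x0, y0)], outside an event of probability [dt].

    On the balls of radius [R] around [(x0, y0)], projected gradient descent
    bounds [T (f (xb, y) - f (x, yb))] by deterministic terms, a multiple of the
    sum of the squared oracle norms, and the noise [<E g - g, u_t - x>].  The
    dependence of the noise on the competitor [x] is removed by a second, ghost,
    descent driven by the noise only: what is left is a martingale.  The noise and
    the squared norms are controlled together: the exponential of a suitable
    linear combination of them, compensated by a constant per step, is a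
    supermartingale, so Markov's inequality bounds the whole sum with a single
    event of probability [dt].

    The resulting bound [m R^2 / 16] on the balls extends to all of [X * Y] by
    strong convexity-concavity, because the initial gap is at most [m R^2 / 8].
    A union bound over the [K] epochs concludes. *)

(** * Euclidean geometry *)

(** The constants of the statement leave little slack. This is why noise and squared norms share one
    Markov bound at level [L = ln (1 / dt)]: two separate events would each need a larger logarithm.
    The regret is multiplied by [c = 80 A / (m R^2)] with [A = 5 + 3 L]; the prescribed step sizes
    then turn the squared norms into [3 |g|^2 / B^2] and the target [m R^2 / 16] into [5 A]. The
    scale [th] of the exponent stays free: it balances the Markov cost [L / th] against the noise
    compensator, which grows linearly in [th]. Since [T] doubles when [R^2] halves, [T R^2] is the
    same in all epochs, and the condition on the first epoch length serves each of them. A second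
    obstacle is measurability: the balls have random centres and the gap is a supremum over
    uncountable sets. A joint modulus of continuity of the projection settles the former, closedness
    of the sublevel sets of the gap the latter. *)

Section EuclideanNorm.
Context {R : realType} {d : nat}.
Implicit Types (u v w : 'rV[R]_d).

Lemma dotC u v : dot u v = dot v u.
Proof. by rewrite /dot; apply: eq_bigr => i _; rewrite mulrC. Qed.

Lemma dotDl u v w : dot (u + v) w = dot u w + dot v w.
Proof.
by rewrite /dot -big_split; apply: eq_bigr => i _; rewrite mxE mulrDl.
Qed.

Lemma dotNl u w : dot (- u) w = - dot u w.
Proof.
by rewrite /dot -sumrN; apply: eq_bigr => i _; rewrite mxE mulNr.
Qed.

Lemma dotZl a u w : dot (a *: u) w = a * dot u w.
Proof.
by rewrite /dot mulr_sumr; apply: eq_bigr => i _; rewrite mxE mulrA.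
Qed.

Lemma dotDr u v w : dot w (u + v) = dot w u + dot w v.
Proof. by rewrite dotC dotDl !(dotC w). Qed.

Lemma dotNr u w : dot w (- u) = - dot w u.
Proof. by rewrite dotC dotNl dotC. Qed.

Lemma dotZr a u w : dot w (a *: u) = a * dot w u.
Proof. by rewrite dotC dotZl dotC. Qed.

Definition dotE := (dotDl, dotDr, dotNl, dotNr, dotZl, dotZr).

Lemma dot0l u : dot 0 u = 0.
Proof. by rewrite -(scale0r 0) dotZl mul0r. Qed.

Lemma dot_suml (I : Type) (r : seq I) (F : I -> 'rV[R]_d) w :
  dot (\sum_(i <- r) F i) w = \sum_(i <- r) dot (F i) w.
Proof.
by elim/big_rec2: _ => [|i x y _ <-]; rewrite ?dot0l// dotDl.
Qed.

Lemma dot_ge0 u : 0 <= dot u u.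
Proof. by apply: sumr_ge0 => i _; rewrite -expr2 sqr_ge0. Qed.

Lemma enorm_ge0 u : 0 <= enorm u.
Proof. exact: sqrtr_ge0. Qed.

Lemma enorm_sqr u : enorm u ^+ 2 = dot u u.
Proof. by rewrite sqr_sqrtr // dot_ge0. Qed.

Lemma enorm0 : enorm (0 : 'rV[R]_d) = 0.
Proof. by rewrite /enorm dot0l sqrtr0. Qed.

Lemma enormN u : enorm (- u) = enorm u.
Proof. by rewrite /enorm !dotE opprK. Qed.

Lemma enormBC u v : enorm (u - v) = enorm (v - u).
Proof. by rewrite -enormN opprB. Qed.

Lemma enormZ a u : enorm (a *: u) = `|a| * enorm u.
Proof. by rewrite /enorm !dotE mulrA -expr2 sqrtrM ?sqr_ge0// sqrtr_sqr. Qed.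

Lemma enorm_le u (r : R) : 0 <= r -> (enorm u <= r) = (dot u u <= r ^+ 2).
Proof.
by move=> r0; rewrite -enorm_sqr ler_pXn2r ?nnegrE ?enorm_ge0.
Qed.

Lemma enorm_eq0 u : enorm u = 0 -> u = 0.
Proof.
move=> u0; have : dot u u = 0 by rewrite -enorm_sqr u0 expr0n.
move=> /eqP; rewrite psumr_eq0 => [/allP h|i _]; last by rewrite -expr2 sqr_ge0.
apply/rowP => i; rewrite mxE; have := h i (mem_index_enum i).
by rewrite /= -expr2 sqrf_eq0 => /eqP.
Qed.

Lemma dot_le_mean u v : dot u v <= (dot u u + dot v v) / 2.
Proof. by have := dot_ge0 (u - v); rewrite !dotE (dotC v u); lra. Qed.

Lemma cauchy_schwarz u v : dot u v <= enorm u * enorm v.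
Proof.
have [u0|u0] := eqVneq (enorm u) 0.
  by rewrite u0 mul0r (enorm_eq0 u0) dot0l.
have [v0|v0] := eqVneq (enorm v) 0.
  by rewrite v0 mulr0 (enorm_eq0 v0) dotC dot0l.
have up : 0 < enorm u by rewrite lt_def u0 enorm_ge0.
have vp : 0 < enorm v by rewrite lt_def v0 enorm_ge0.
have := dot_le_mean ((enorm u)^-1 *: u) ((enorm v)^-1 *: v).
rewrite !dotE -!enorm_sqr.
have -> : ((enorm u)^-1 * ((enorm u)^-1 * enorm u ^+ 2) +
   (enorm v)^-1 * ((enorm v)^-1 * enorm v ^+ 2)) / 2 = 1.
  by field; rewrite u0 v0.
by rewrite mulrA -invfM mulrC ler_pdivrMr ?mulr_gt0 // mul1r mulrC (mulrC (enorm v)).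
Qed.

Lemma cauchy_schwarz_abs u v : `|dot u v| <= enorm u * enorm v.
Proof.
rewrite ler_norml cauchy_schwarz andbT lerNl -dotNl -(enormN u).
exact: cauchy_schwarz.
Qed.

Lemma enormD u v : enorm (u + v) <= enorm u + enorm v.
Proof.
rewrite enorm_le ?addr_ge0 ?enorm_ge0 // !dotE (dotC v u) sqrrD !enorm_sqr.
by have := cauchy_schwarz u v; lra.
Qed.

Lemma enorm_triangle u v w : enorm (u - w) <= enorm (u - v) + enorm (v - w).
Proof. by rewrite (le_trans _ (enormD _ _)) // addrA subrK. Qed.

Lemma ge0_enorm_dist u v : enorm u - enorm v <= enorm (u - v).
Proof. by rewrite lerBlDr (le_trans _ (enormD _ _)) // subrK. Qed.

Lemma coord_le_enorm u i : `|u ord0 i| <= enorm u.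
Proof.
rewrite -[leLHS]sqrtr_sqr ler_wsqrtr // /dot (bigD1 i)//= -expr2 lerDl.
by apply: sumr_ge0 => j _; rewrite -expr2 sqr_ge0.
Qed.

Lemma norm_le_enorm u : `|u| <= enorm u.
Proof.
rewrite /Num.norm /= mx_normrE.
apply/bigmax_leP; split => [|[i j] _ /=]; first exact: enorm_ge0.
by rewrite (ord1 i) coord_le_enorm.
Qed.

Lemma coord_le_norm u i : `|u ord0 i| <= `|u|.
Proof.
rewrite [leRHS]/Num.norm /= mx_normrE.
by apply/bigmax_geP; right; exists (ord0, i).
Qed.

Lemma enorm_le_norm u : enorm u <= Num.sqrt d%:R * `|u|.
Proof.
rewrite -(ger0_norm (normr_ge0 u)) -sqrtr_sqr -sqrtrM ?ler0n //.
rewrite ler_wsqrtr // /dot (le_trans (y := \sum_(i < d) `|u| ^+ 2)) //.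
  apply: ler_sum => i _; rewrite -expr2 -real_normK ?num_real //.
  by rewrite lerXn2r ?nnegrE ?normr_ge0 ?coord_le_norm.
by rewrite sumr_const card_ord mulr_natl.
Qed.

End EuclideanNorm.

(** * Metric projection and the regret of projected descent *)

Section Projection.
Context {R : realType} {d : nat}.
Implicit Types (u v p q x c : 'rV[R]_d) (C : set 'rV[R]_d).

Lemma continuous_coord i : continuous (fun u : 'rV[R]_d => u ord0 i).
Proof. exact: coord_continuous. Qed.

Lemma continuous_dot (T : topologicalType) (f g : T -> 'rV[R]_d) :
  continuous f -> continuous g -> continuous (fun t => dot (f t) (g t)).
Proof.
move=> cf cg t; apply: cvg_big => [|i _]; first exact: add_continuous.
apply: cvgM.
  exact: (continuous_comp (cf t) (@continuous_coord i _)).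
exact: (continuous_comp (cg t) (@continuous_coord i _)).
Qed.

Lemma continuous_enorm : continuous (@enorm R d).
Proof.
move=> u; apply: (continuous_comp (f := fun u => dot u u)) => //.
  by apply: continuous_dot => ?; exact: cvg_id.
exact: sqrt_continuous.
Qed.

Lemma continuous_enormB c : continuous (fun z : 'rV[R]_d => enorm (z - c)).
Proof.
move=> z; apply: (continuous_comp (f := fun z : 'rV[R]_d => z - c)).
  exact: (cvgB cvg_id (cvg_cst c)).
exact: continuous_enorm.
Qed.

Lemma closed_eball c r : closed (eball c r).
Proof.
apply: (@closed_comp _ _ (fun z : 'rV[R]_d => enorm (z - c)) [set t | t <= r]).
  by move=> z _; exact: continuous_enormB.
exact: closed_le.
Qed.

Lemma convex_comb C : convex_set C ->
  forall u v t, C u -> C v -> 0 <= t <= 1 -> C ((1 - t) *: u + t *: v).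
Proof.
move=> cC u v t Cu Cv /andP[t0 t1].
have := cC v u (Itv01 t0 t1).
rewrite !inE => /(_ Cv Cu).
by rewrite /conv /= addrC.
Qed.

(** Convexity is binary, so the mean of [n + 2] points is split into the mean of the first [n + 1],
    with weight [1 - 1 / (n + 2)], and the last point. *)
Lemma convex_mean C (n : nat) (F : nat -> 'rV[R]_d) : convex_set C ->
  (0 < n)%N -> (forall i, (i < n)%N -> C (F i)) ->
  C (n%:R^-1 *: \sum_(i < n) F i).
Proof.
move=> cC; case: n => // n _; elim: n => [|n IH] CF.
  by rewrite big_ord1 invr1 scale1r; exact: CF.
have n1 : (n.+1%:R : R) != 0 by rewrite pnatr_eq0.
have n2 : (n.+2%:R : R) != 0 by rewrite pnatr_eq0.
rewrite big_ord_recr /= scalerDr.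
have -> : n.+2%:R^-1 *: \sum_(i < n.+1) F i =
    (1 - n.+2%:R^-1) *: (n.+1%:R^-1 *: \sum_(i < n.+1) F i).
  by rewrite scalerA; congr (_ *: _); move: n1 n2; rewrite -!natr1 => n1 n2; field; rewrite n1 n2.
apply: (convex_comb cC).
- by apply: IH => i ilt; apply: CF; rewrite ltnW.
- exact: CF.
- by rewrite invr_ge0 ler0n /= invf_le1 ?ltr0n // ler1n.
Qed.

Lemma eball_convex c r : convex_set (eball c r).
Proof.
move=> /= u v t; rewrite !inE /eball /= => uc vc.
have t0 : 0 <= t%:num by [].
have t1 : 0 <= 1 - t%:num by rewrite subr_ge0.
rewrite /conv /=.
have -> : t%:num *: (u : 'rV[R]_d) + (1 - t%:num) *: (v : 'rV[R]_d) - c =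
   t%:num *: (u - c) + (1 - t%:num) *: (v - c).
  by apply/rowP => i; rewrite !mxE; ring.
apply: (le_trans (enormD _ _)); rewrite !enormZ !ger0_norm //.
apply: (@le_trans _ _ (t%:num * r + (1 - t%:num) * r)).
  by rewrite lerD // ler_wpM2l.
by rewrite -mulrDl addrC subrK mul1r.
Qed.

Lemma convex_setI C C' : convex_set C -> convex_set C' -> convex_set (C `&` C').
Proof.
move=> cC cC' u v t; rewrite !inE => -[uC uC'] [vC vC'].
by split; apply/set_mem; [apply: cC|apply: cC']; rewrite inE.
Qed.

(** Points of [C] farther from [x] than [q0] cannot be minimisers. The others form a compact set, on
    which the distance attains its minimum; so the default value in [proj] does not occur. *)
Lemma proj_min C x q0 : closed C -> C q0 ->
  C (proj C x) /\ forall q, C q -> enorm (x - proj C x) <= enorm (x - q).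
Proof.
move=> cC Cq0; rewrite /proj.
suff : exists p, C p /\ forall q, C q -> enorm (x - p) <= enorm (x - q).
  by move=> h; exact: (xgetPex 0 h).
pose A := C `&` eball x (enorm (x - q0)).
have A0 : A !=set0 by exists q0; split => //; rewrite /eball /= enormBC.
have cA : compact A.
  apply: bounded_closed_compact; last by apply: closedI => //; exact: closed_eball.
  exists (enorm (x - q0) + enorm x); split => [|M MN u [_ ux]] /=.
    exact: num_real.
  apply: le_trans (ltW MN); rewrite (le_trans (norm_le_enorm u)) // -lerBlDr.
  exact: (le_trans (ge0_enorm_dist _ _) ux).
have cf : {within A, continuous (fun p : 'rV[R]_d => enorm (p - x))}.
  by apply: continuous_subspaceT; exact: continuous_enormB.
have [p /set_mem[Cp xp] pmin] := compact_EVT_min A0 cA cf.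
exists p; split => // q Cq.
have [h|h] := leP (enorm (x - q)) (enorm (x - q0)).
  rewrite (enormBC x p) (enormBC x q); apply: pmin; apply/mem_set; split => //.
  rewrite /eball /= (enormBC q x). exact: h.
by apply: le_trans (ltW h); rewrite enormBC.
Qed.

Lemma proj_obtuse C x q : closed C -> convex_set C -> C q ->
  dot (x - proj C x) (q - proj C x) <= 0.
Proof.
move=> cC vC Cq; have [Cp pmin] := proj_min x cC Cq.
set p := proj C x in Cp pmin *.
rewrite leNgt; apply/negP => a0.
set a := dot _ _ in a0; pose b := dot (q - p) (q - p).
have b0 : 0 <= b := dot_ge0 _.
have key t : 0 < t -> t <= 1 -> 2 * a <= t * b.
  move=> t0 t1.
  have := pmin _ (convex_comb vC Cp Cq (introT andP (conj (ltW t0) t1))).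
  have -> : x - ((1 - t) *: p + t *: q) = (x - p) - t *: (q - p).
    by apply/rowP => i; rewrite !mxE; ring.
  rewrite enorm_le ?enorm_ge0 // enorm_sqr.
  have -> : dot (x - p - t *: (q - p)) (x - p - t *: (q - p)) =
      dot (x - p) (x - p) - t * (2 * a - t * b).
    rewrite /a /b; move: (x - p) (q - p) => v w.
    by rewrite !dotE (dotC w v); ring.
  by rewrite lerBrDr gerDl pmulr_rle0 // subr_le0.
have ab : 0 < a + b by lra.
(* The value [t = a / (a + b)] is at most 1 and gives [t * b <= a < 2 * a]. It also covers [b = 0],
   where [a / b] would fail. *)
have := key (a / (a + b)); rewrite divr_gt0 // ler_pdivrMr // mul1r lerDl.
move=> /(_ isT b0); rewrite -mulrA (mulrC _ b).
have : a * (b / (a + b)) <= a.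
  by rewrite ler_piMr ?(ltW a0) // ler_pdivrMr // mul1r lerDr ltW.
by lra.
Qed.

Lemma proj_contract C x q : closed C -> convex_set C -> C q ->
  dot (proj C x - q) (proj C x - q) <= dot (x - q) (x - q).
Proof.
move=> cC vC Cq; have := proj_obtuse x cC vC Cq; set p := proj C x => h.
have -> : x - q = (x - p) + (p - q) by rewrite addrA subrK.
move: h; rewrite -(opprB p q) dotNr; move: (x - p) (p - q) => v w.
by rewrite !dotE (dotC w v); have := dot_ge0 v; lra.
Qed.

Lemma regret_bound C (eta : R) (u h : nat -> 'rV[R]_d) x n :
  closed C -> convex_set C -> C x -> 0 < eta ->
  (forall t, u t.+1 = proj C (u t - eta *: h t)) ->
  \sum_(t < n) dot (h t) (u t - x) <=
    dot (u 0%N - x) (u 0%N - x) / (2 * eta) +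
    eta / 2 * \sum_(t < n) dot (h t) (h t).
Proof.
move=> cC vC Cx e0 uS.
(* The final distance, dropped in the statement, is kept for the induction: it is the term that
   telescopes. *)
suff : \sum_(t < n) dot (h t) (u t - x) <=
    dot (u 0%N - x) (u 0%N - x) / (2 * eta) -
    dot (u n - x) (u n - x) / (2 * eta) +
    eta / 2 * \sum_(t < n) dot (h t) (h t).
  have : 0 <= dot (u n - x) (u n - x) / (2 * eta).
    by rewrite divr_ge0 ?dot_ge0 // mulr_ge0 // ltW.
  lra.
elim: n => [|n IH]; first by rewrite !big_ord0 mulr0 subrr addr0.
rewrite !big_ord_recr /=.
have := proj_contract (u n - eta *: h n) cC vC Cx; rewrite -uS.
have -> : u n - eta *: h n - x = (u n - x) - eta *: h n.
  by rewrite addrAC.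
move: IH; set v := u n - x; set S1 := \sum_(_ < _) _; set S2 := \sum_(_ < _) _.
set a := dot (u 0%N - x) _; set b := dot (u n.+1 - x) _ => IH.
clearbody v.
rewrite !dotE (dotC v) => H.
have e2 : 0 < (2 * eta)^-1 by rewrite invr_gt0 mulr_gt0.
have : dot (h n) v <= (dot v v - b) / (2 * eta) + eta / 2 * dot (h n) (h n).
  rewrite -subr_ge0.
  have -> : (dot v v - b) / (2 * eta) + eta / 2 * dot (h n) (h n) - dot (h n) v
    = (dot v v + - (eta * dot (h n) v) + (- (eta * dot (h n) v) -
     - (eta * (eta * dot (h n) (h n)))) - b) / (2 * eta).
    by field; rewrite gt_eqF.
  by rewrite mulr_ge0 ?(ltW e2) // subr_ge0; move: H; lra.
by move: IH; lra.
Qed.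

(* Moving [p] towards the centre [c] by a fraction [|c - c'| / r] lands in the
   ball around [c'], so each projection nearly competes with the other one. *)
Lemma proj_ball_modulus C c c' u u' r : closed C -> convex_set C ->
  C c -> C c' -> 0 < r -> enorm (c - c') <= r ->
  let p := proj (C `&` eball c r) u in
  let p' := proj (C `&` eball c' r) u' in
  dot (p - p') (p - p') <= enorm (u - u') ^+ 2 +
    2 * enorm (c - c') * (enorm (u - c) + enorm (u' - c')).
Proof.
move=> cC vC Cc Cc' r0 cr.
have key (a a' v v' : 'rV[R]_d) : C a -> C a' -> enorm (a - a') <= r ->
   let q := proj (C `&` eball a r) v in
   let q' := proj (C `&` eball a' r) v' in
   dot (v - q) (q' - q) <= enorm (a - a') * enorm (v - a).
  move=> Ca Ca' ar /=; set q := proj _ v; set q' := proj _ v'.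
  have Aa b : C b -> (C `&` eball b r) b.
    by move=> ?; split => //; rewrite /eball /= subrr enorm0 ltW.
  have cl b : closed (C `&` eball b r) by apply: closedI => //; exact: closed_eball.
  have cv b : convex_set (C `&` eball b r).
    by apply: convex_setI => //; exact: eball_convex.
  have [[Cq qa] qmin] := proj_min v (cl a) (Aa _ Ca).
  have [[Cq' qa'] _] := proj_min v' (cl a') (Aa _ Ca').
  rewrite -/q -/q' in Cq qa qmin Cq' qa'.
  pose s := enorm (a - a') / r.
  have s0 : 0 <= s by rewrite divr_ge0 ?enorm_ge0 // ltW.
  have s1 : s <= 1 by rewrite ler_pdivrMr // mul1r.
  pose z := (1 - s) *: q' + s *: a'.
  have Cz : C z by apply: (convex_comb vC) => //; rewrite s0.
  have za : eball a r z.
    rewrite /eball /=; apply: (le_trans (enorm_triangle _ a' _)).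
    have -> : z - a' = (1 - s) *: (q' - a').
      by apply/rowP => i; rewrite /z !mxE; ring.
    rewrite enormZ ger0_norm ?subr_ge0 // (enormBC a').
    apply: (@le_trans _ _ ((1 - s) * r + enorm (a - a'))).
      by rewrite lerD2r ler_wpM2l ?subr_ge0.
    by rewrite mulrBl mul1r /s divfK ?gt_eqF // subrK.
  have zq : enorm (q' - z) <= enorm (a - a').
    have -> : q' - z = s *: (q' - a').
      by apply/rowP => i; rewrite /z !mxE; ring.
    rewrite enormZ ger0_norm // (@le_trans _ _ (s * r)) ?ler_wpM2l //.
    by rewrite /s divfK ?gt_eqF.
  have := proj_obtuse v (cl a) (cv a) (conj Cz za); rewrite -/q => h.
  have -> : q' - q = (z - q) + (q' - z) by rewrite [RHS]addrC addrA subrK.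
  rewrite dotDr; apply: (@le_trans _ _ (dot (v - q) (q' - z))); first by rewrite gerDr.
  rewrite (le_trans (cauchy_schwarz _ _)) // mulrC ler_pM ?enorm_ge0 //.
  exact: (qmin _ (Aa _ Ca)).
rewrite /=; set p := proj _ u; set p' := proj _ u'.
have h1 := key _ _ u u' Cc Cc' cr.
have h2 := key _ _ u' u Cc' Cc; rewrite enormBC in h2; have {}h2 := h2 cr.
rewrite /= -/p -/p' in h1 h2.
(* The two one-sided bounds add up to a bound on [|p - p'|^2 - <u - u', p - p'>]; the mean
   inequality absorbs half of [|p - p'|^2]. *)
have := dot_le_mean (u - u') (p - p'); rewrite enorm_sqr.
have : dot (u - p) (p' - p) + dot (u' - p') (p - p') =
   dot (p - p') (p - p') - dot (u - u') (p - p').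
  by rewrite !dotE (dotC p' p); ring.
lra.
Qed.

End Projection.

(** * Exponential moments *)

Section ExpBounds.
Context {R : realType}.
Implicit Types x y v : R.

Lemma expR_tangent v x : expR v * (1 + (x - v)) <= expR x.
Proof.
have -> : expR x = expR v * expR (x - v) by rewrite -expRD addrC subrK.
by rewrite ler_wpM2l ?expR_ge0 // expR_ge1Dx.
Qed.

Lemma expR_le_inv x : x < 1 -> expR x <= (1 - x)^-1.
Proof.
move=> x1; rewrite -[expR x]invrK -expRN lef_pV2 ?posrE ?expR_gt0 ?subr_gt0 //.
exact: expR_ge1Dx.
Qed.

Lemma expR_mono_conv2 t x : 0 <= t <= 1 -> expR (t * x) <= 1 - t + t * expR x.
Proof.
move=> /andP[t0 t1].
have := ler_wpM2l t0 (expR_tangent (t * x) x).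
have := ler_wpM2l (_ : 0 <= 1 - t) (expR_tangent (t * x) 0).
rewrite subr_ge0 expR0 => /(_ t1); lra.
Qed.

(** Jensen's inequality for four points: the tangent at the barycentre [v] minorises [expR], and its
    linear parts cancel in the weighted sum. *)
Lemma expR_conv4 (a b p q x y z w : R) :
  0 <= a -> 0 <= b -> 0 <= p -> 0 <= q -> a + b + p + q = 1 ->
  expR (a * x + b * y + p * z + q * w) <=
    a * expR x + b * expR y + p * expR z + q * expR w.
Proof.
move=> a0 b0 p0 q0 E; set v := a * x + b * y + p * z + q * w.
have hx := ler_wpM2l a0 (expR_tangent v x).
have hy := ler_wpM2l b0 (expR_tangent v y).
have hz := ler_wpM2l p0 (expR_tangent v z).
have hw := ler_wpM2l q0 (expR_tangent v w).
have -> : expR v = a * (expR v * (1 + (x - v))) + b * (expR v * (1 + (y - v))) +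
    p * (expR v * (1 + (z - v))) + q * (expR v * (1 + (w - v))).
  transitivity (expR v * ((a + b + p + q) * (1 - v) + v)); last by rewrite {3}/v; ring.
  by rewrite E; ring.
lra.
Qed.

(** Squaring [1 + y + c * y ^+ 2] and bounding the cubic and quartic terms through [y <= b]
    transfers a quadratic bound on [expR] from [[0, b]] to [[0, 2 b]], with a new constant [c']. *)
Lemma expR_double c c' b y : 0 <= y <= b -> 0 <= c ->
  1 + 2 * c + 2 * c * b + c ^+ 2 * b ^+ 2 <= 4 * c' ->
  expR y <= 1 + y + c * y ^+ 2 ->
  expR (2 * y) <= 1 + 2 * y + c' * (2 * y) ^+ 2.
Proof.
move=> /andP[y0 yb] c0 H h.
have -> : 2 * y = y + y by ring.
rewrite expRD -expr2; apply: (@le_trans _ _ ((1 + y + c * y ^+ 2) ^+ 2)).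
  by rewrite lerXn2r ?nnegrE ?expR_ge0 // (le_trans (expR_ge0 y)).
rewrite -subr_ge0.
have -> : 1 + (y + y) + c' * (y + y) ^+ 2 - (1 + y + c * y ^+ 2) ^+ 2 =
  y ^+ 2 * (4 * c' - (1 + 2 * c + 2 * c * y + c ^+ 2 * y ^+ 2)) by ring.
rewrite mulr_ge0 ?sqr_ge0 // subr_ge0 (le_trans _ H) // lerD //.
  by rewrite lerD // ler_wpM2l // mulr_ge0.
by rewrite ler_wpM2l ?sqr_ge0 // lerXn2r ?nnegrE // (le_trans y0).
Qed.

(** On [[0, 1/8]] the bound [1 / (1 - y)] yields the constant [8/7]. Three doublings reach [[0, 1]],
    with constants [9/10], [83/100] and [1], each a rounding up allowed by [expR_double]. *)
Lemma expR_le_quad x : 0 <= x <= 1 -> expR x <= 1 + x + x ^+ 2.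
Proof.
move=> /andP[x0 x1]; pose y := x / 8.
have y01 : 0 <= y <= 8^-1 by rewrite /y; lra.
have h1 : expR y <= 1 + y + 8 / 7 * y ^+ 2.
  apply: (le_trans (expR_le_inv _)); first by move: y01; lra.
  rewrite -[leLHS]mul1r ler_pdivrMr; last by move: y01; lra.
  rewrite -subr_ge0.
  have -> : (1 + y + 8 / 7 * y ^+ 2) * (1 - y) - 1 = y ^+ 2 * (8 / 7 * (8^-1 - y)).
    by field.
  by rewrite mulr_ge0 ?sqr_ge0 //; move: y01; lra.
have h2 := expR_double (c' := 9 / 10) y01 _ _ h1.
have {}h2 : expR (2 * y) <= 1 + 2 * y + 9 / 10 * (2 * y) ^+ 2 by apply: h2; lra.
have y2 : 0 <= 2 * y <= 4^-1 by move: y01; lra.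
have h3 := expR_double (c' := 83 / 100) y2 _ _ h2.
have {}h3 : expR (2 * (2 * y)) <= 1 + 2 * (2 * y) + 83 / 100 * (2 * (2 * y)) ^+ 2.
  by apply: h3; lra.
have y3 : 0 <= 2 * (2 * y) <= 2^-1 by move: y01; lra.
have h4 := expR_double (c' := 1) y3 _ _ h3.
have -> : x = 2 * (2 * (2 * y)) by rewrite /y; field.
by rewrite -[X in _ <= _ + X]mul1r; apply: h4; lra.
Qed.

(** This plays the part of a Taylor expansion for moment generating functions: after integration the
    linear term is the mean, and the remainder is an exponential moment of the square. For [x < 0]
    it rests on [(1 + x + x^2) (1 - x) = 1 - x^3 >= 1]. *)
Lemma expR_le_sq x : expR x <= x + expR (x ^+ 2).
Proof.
have hq := expR_ge1Dx (x ^+ 2).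
have [x0|x0] := leP 0 x.
  have [x1|x1] := leP x 1.
    by have := @expR_le_quad x; rewrite x0 x1 => /(_ isT); lra.
  rewrite (@le_trans _ _ (expR (x ^+ 2))) ?lerDr // ler_expR expr2.
  by rewrite ler_peMr // ltW.
apply: (le_trans (expR_le_inv _)); first lra.
rewrite -[leLHS]mul1r ler_pdivrMr; last lra.
apply: (@le_trans _ _ ((x + (1 + x ^+ 2)) * (1 - x))).
  have -> : (x + (1 + x ^+ 2)) * (1 - x) = 1 + (- x) * x ^+ 2 by ring.
  by rewrite lerDl mulr_ge0 ?sqr_ge0 //; lra.
by rewrite ler_wpM2r ?lerD2l //; lra.
Qed.

End ExpBounds.

Section ExpMoments.
Context {R : realType} {dT : measure_display} {T : measurableType dT}.
Variable D : probability T R.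
Implicit Types f g X : T -> R.

Let intg f := D.-integrable setT (EFin \o f).

Lemma ge0_integrable_le f (c : R) : measurable_fun setT f ->
  (forall x, 0 <= f x) -> (\int[D]_s (f s)%:E <= c%:E)%E ->
  D.-integrable setT (EFin \o f) /\ \int[D]_s f s <= c.
Proof.
move=> mf f0 fc.
have fi : intg f.
  apply/integrableP; split; first exact/measurable_EFinP.
  under eq_integral do rewrite /= ger0_norm //.
  by rewrite (le_lt_trans fc) // ltry.
split => //; rewrite -lee_fin /Rintegral fineK //.
exact: (integrable_fin_num _ fi).
Qed.

Lemma EFin_Rintegral f : D.-integrable setT (EFin \o f) ->
  (\int[D]_s (f s)%:E)%E = (\int[D]_s f s)%:E.
Proof. by move=> fi; rewrite /Rintegral fineK //; exact: (integrable_fin_num _ fi). Qed.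

Lemma integrable_dominated f g : measurable_fun setT f ->
  (forall x, `|f x| <= g x) -> D.-integrable setT (EFin \o g) ->
  D.-integrable setT (EFin \o f).
Proof.
move=> mf fg; apply: le_integrable => //; first exact/measurable_EFinP.
by move=> x _; rewrite /= lee_fin (le_trans (fg x)) // ler_norm.
Qed.

Lemma Rintegral_affine f (a b : R) : D.-integrable setT (EFin \o f) ->
  D.-integrable setT (EFin \o (fun x => a + b * f x)) /\
  \int[D]_s (a + b * f s) = a + b * \int[D]_s f s.
Proof.
move=> fi.
have ai : intg (cst a) by exact: finite_measure_integrable_cst.
have bi : intg (fun x => b * f x) by exact: (integrableZl _ b fi).
split; first exact: (integrableD _ ai bi).
rewrite RintegralD // RintegralZl //. rewrite Rintegral_cst //; congr (_ + _).
have -> : fine (D [set: T]) = 1 by exact: (congr1 fine (probability_setT D)).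
exact: mulr1.
Qed.

Section one_variable.
Variables (F : T -> R).
Hypotheses (mF : measurable_fun setT F)
  (eF : (\int[D]_s (expR (F s))%:E <= (expR 1)%:E)%E).

Lemma exp_moment_integrable :
  D.-integrable setT (EFin \o (fun x => expR (F x))) /\
  \int[D]_s expR (F s) <= expR 1.
Proof.
apply: ge0_integrable_le => //.
exact: measurableT_comp.
Qed.

(** Convexity gives [expR (t (F - 1)) <= 1 - t + t * expR (F - 1)] pointwise, and the last
    exponential has mean at most 1. *)
Lemma exp_moment_power (t : R) : 0 <= t <= 1 ->
  D.-integrable setT (EFin \o (fun x => expR (t * (F x - 1)))) /\
  \int[D]_s expR (t * (F s - 1)) <= 1.
Proof.
move=> t01; have [ei eE] := exp_moment_integrable.
have [ai aE] := Rintegral_affine (1 - t) (t * expR (- 1)) ei.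
have le x : expR (t * (F x - 1)) <= 1 - t + t * expR (- 1) * expR (F x).
  by rewrite -mulrA -expRD (addrC (- 1) (F x)) expR_mono_conv2.
have ti : intg (fun x => expR (t * (F x - 1))).
  apply: integrable_dominated ai => // [|x]; last by rewrite ger0_norm ?expR_ge0.
  apply: measurableT_comp => //; apply: measurable_funM => //.
  exact: measurable_funB.
split => //; apply: (@le_trans _ _ (\int[D]_s (1 - t + t * expR (- 1) * expR (F s)))).
  exact: le_Rintegral.
rewrite aE -mulrA -lerBrDl opprB addrCA subrr addr0.
move: t01 => /andP[t0 _]; rewrite ler_piMr // mulrC -ler_pdivlMr ?expR_gt0 //.
by rewrite -expRN opprK mul1r.
Qed.

End one_variable.

(** Both claims come from [|X| <= (1 + X^2) / 2] and [X^2 <= expR (X^2 - 1)], whose right-hand side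
    has mean at most 1. *)
Lemma exp_sq_moment X : measurable_fun setT X ->
  (\int[D]_s (expR (X s ^+ 2))%:E <= (expR 1)%:E)%E ->
  D.-integrable setT (EFin \o X) /\ \int[D]_s X s <= 1.
Proof.
move=> mX eX.
have mX2 : measurable_fun setT (fun s => X s ^+ 2) by exact: measurable_funX.
have [ei eE] := exp_moment_integrable mX2 eX.
have [ai aE] := Rintegral_affine (1 / 2) (expR (- 1) / 2) ei.
have sq x : 2 * `|x| <= 1 + x ^+ 2 :> R.
  rewrite -subr_ge0 -[x ^+ 2]real_normK ?num_real //.
  by have := sqr_ge0 (`|x| - 1); rewrite sqrrB1; lra.
have le x : `|X x| <= 1 / 2 + expR (- 1) / 2 * expR (X x ^+ 2).
  have -> : expR (- 1) / 2 * expR (X x ^+ 2) = expR (X x ^+ 2 - 1) / 2.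
    by rewrite expRD; ring.
  by have := expR_ge1Dx (X x ^+ 2 - 1); have := sq (X x); lra.
have Xi : intg X by exact: integrable_dominated ai.
split => //; apply: (@le_trans _ _ (\int[D]_s (1 / 2 + expR (- 1) / 2 * expR (X s ^+ 2)))).
  by apply: le_Rintegral => // x _; rewrite (le_trans (ler_norm _)).
rewrite aE; have h : expR (- 1) * (\int[D]_s expR (X s ^+ 2)) <= 1.
  by rewrite mulrC -ler_pdivlMr ?expR_gt0 // -expRN opprK mul1r.
lra.
Qed.

(* The factor [3/2] is what makes the first-epoch length of the statement
   suffice when [ln (1 / dt)] is small; [4] holds without restriction on [s]. *)
Lemma centered_exp_moment X (s k : R) : measurable_fun setT X ->
  (\int[D]_x (expR (X x ^+ 2))%:E <= (expR 1)%:E)%E -> 0 <= s ->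
  (s ^+ 2 <= 3^-1 /\ k = 3 / 2) \/ k = 4 ->
  let Y x := expR (s * (\int[D]_u X u - X x) - k * s ^+ 2) in
  D.-integrable setT (EFin \o Y) /\ \int[D]_x Y x <= 1.
Proof.
move=> mX eX s0 sk Y; set mu := \int[D]_u X u in Y *.
have [Xi mu1] := exp_sq_moment mX eX; rewrite -/mu in mu1.
have mX2 : measurable_fun setT (fun s => X s ^+ 2) by exact: measurable_funX.
have [e2i e2E] := exp_moment_integrable mX2 eX.
pose c := expR (s * mu - k * s ^+ 2).
have YE x : Y x = c * expR (- s * X x).
  by rewrite /Y /c -expRD; congr expR; ring.
have mY : measurable_fun setT Y.
  rewrite (_ : Y = fun x => c * expR (- s * X x)); last exact/funext.
  apply: measurable_funM => //; apply: measurableT_comp => //.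
  exact: measurable_funM.
(* [- s X <= X^2 + s^2 / 4] *)
have le0 x : expR (- s * X x) <= expR (s ^+ 2 / 4) * expR (X x ^+ 2).
  rewrite -expRD ler_expR -subr_ge0.
  have -> : s ^+ 2 / 4 + X x ^+ 2 - - s * X x = (X x + s / 2) ^+ 2 by field.
  exact: sqr_ge0.
have [di dE] := Rintegral_affine 0 (c * expR (s ^+ 2 / 4)) e2i.
have c0 : 0 <= c := expR_ge0 _.
have Yi : intg Y.
  apply: integrable_dominated di => // x.
  by rewrite YE ger0_norm ?mulr_ge0 ?expR_ge0 // add0r -mulrA ler_wpM2l.
split => //.
(* For large [s] the crude bound [le0] and [mu <= 1] suffice, as [k = 4] makes the total exponent
   negative. For small [s], [expR_le_sq] is applied to [- s X] and the moment of [s^2 X^2] is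
   bounded by [expR (s^2)]. *)
have [s1|s1] := leP (s ^+ 2) (3 / 4); last first.
  have k4 : k = 4 by case: sk => // -[s3 _]; move: s1; lra.
  apply: (@le_trans _ _ (\int[D]_x (0 + c * expR (s ^+ 2 / 4) * expR (X x ^+ 2)))).
    by apply: le_Rintegral => // x _; rewrite YE add0r -mulrA ler_wpM2l.
  rewrite dE add0r; apply: (@le_trans _ _ (c * expR (s ^+ 2 / 4) * expR 1)).
    by rewrite ler_wpM2l // mulr_ge0 ?expR_ge0.
  rewrite /c k4 -!expRD -[leRHS]expR0 ler_expR.
  have h : s * mu <= s by rewrite ler_piMr.
  have := sqr_ge0 (s - 1); rewrite sqrrB1; move: s1 h; lra.
have s01 : 0 <= s ^+ 2 <= 1 by rewrite sqr_ge0; move: s1; lra.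
have [pi pE] := exp_moment_power mX2 eX s01.
have [ai aE] := Rintegral_affine 0 (- s) Xi.
have [bi bE] := Rintegral_affine 0 (expR (s ^+ 2)) pi.
have le1 x : expR (- s * X x) <= (0 + - s * X x) +
    (0 + expR (s ^+ 2) * expR (s ^+ 2 * (X x ^+ 2 - 1))).
  rewrite !add0r -expRD (le_trans (expR_le_sq _)) // lerD2l ler_expR.
  by rewrite exprMn sqrrN; lra.
have gi : intg (fun x => (0 + - s * X x) +
    (0 + expR (s ^+ 2) * expR (s ^+ 2 * (X x ^+ 2 - 1)))).
  exact: (integrableD _ ai bi).
have [ci cE] := Rintegral_affine 0 c gi.
apply: (@le_trans _ _ (\int[D]_x (0 + c * ((0 + - s * X x) +
    (0 + expR (s ^+ 2) * expR (s ^+ 2 * (X x ^+ 2 - 1))))))).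
  by apply: le_Rintegral => // x _; rewrite YE add0r ler_wpM2l.
rewrite cE RintegralD // aE bE -/mu !add0r.
apply: (@le_trans _ _ (c * (- s * mu + expR (s ^+ 2)))).
  by rewrite ler_wpM2l // lerD2l ler_piMr ?expR_ge0.
apply: (@le_trans _ _ (c * expR (- s * mu + expR (s ^+ 2) - 1))).
  rewrite ler_wpM2l //.
  by have := expR_ge1Dx (- s * mu + expR (s ^+ 2) - 1); lra.
rewrite /c -expRD -[leRHS]expR0 ler_expR.
(* By [expR q <= 1 / (1 - q)] it is enough that [k (1 - s^2) >= 1]; equality holds at [s^2 = 1/3]
   for [k = 3/2] and at [s^2 = 3/4] for [k = 4], which explains the thresholds. *)
have h : expR (s ^+ 2) - 1 <= k * s ^+ 2.
  have ie : expR (s ^+ 2) <= (1 - s ^+ 2)^-1 by apply: expR_le_inv; move: s1; lra.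
  rewrite lerBlDr (le_trans ie) // -[leLHS]mul1r ler_pdivrMr; last by move: s1; lra.
  have -> : (k * s ^+ 2 + 1) * (1 - s ^+ 2) = 1 + s ^+ 2 * (k * (1 - s ^+ 2) - 1).
    by ring.
  rewrite lerDl mulr_ge0 ?sqr_ge0 //.
  by case: sk => [[s3 ->]|->]; [move: s3|move: s1]; lra.
by move: h; lra.
Qed.

End ExpMoments.

(** * Moments of the directional components of a random vector *)

Section VectorMoments.
Context {R : realType} {dT : measure_display} {T : measurableType dT}.
Variables (D : probability T R) (n : nat) (g : T -> 'rV[R]_n) (B : R).
Hypotheses (mg : forall i, measurable_fun setT (fun s => g s ord0 i)).
Hypotheses (B_gt0 : 0 < B)
  (eg : (\int[D]_s (expR (enorm (g s) ^+ 2 / B ^+ 2))%:E <= (expR 1)%:E)%E).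

Lemma measurable_dot (h : T -> 'rV[R]_n) :
  (forall i, measurable_fun setT (fun s => h s ord0 i)) ->
  measurable_fun setT (fun s => dot (g s) (h s)).
Proof.
move=> mh.
exact: (measurable_sum _ (fun i => measurable_funM (mg i) (mh i))).
Qed.

Lemma measurable_dotl z : measurable_fun setT (fun s => dot (g s) z).
Proof. by apply: measurable_dot => i; exact: measurable_cst. Qed.

Lemma measurable_enorm : measurable_fun setT (fun s => enorm (g s)).
Proof.
apply: (measurableT_comp (f := @Num.sqrt R)).
  by apply: continuous_measurable_fun; exact: sqrt_continuous.
exact: measurable_dot.
Qed.

Lemma exp_sq_le_moment (X : T -> R) : measurable_fun setT X ->
  (forall s, X s ^+ 2 <= enorm (g s) ^+ 2 / B ^+ 2) ->
  (\int[D]_s (expR (X s ^+ 2))%:E <= (expR 1)%:E)%E.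
Proof.
move=> mX XU; apply: (le_trans _ eg); apply: ge0_le_integral => //.
- apply/measurable_EFinP/measurableT_comp => //; exact: measurable_funX.
- apply/measurable_EFinP/measurableT_comp => //; apply: measurable_funM => //.
  by apply: measurable_funX; exact: measurable_enorm.
- by move=> s _; rewrite lee_fin ler_expR.
Qed.

Lemma moment_dot_sq (z : 'rV[R]_n) (r : R) : 0 < r -> enorm z <= r ->
  (\int[D]_s (expR ((dot (g s) z / (r * B)) ^+ 2))%:E <= (expR 1)%:E)%E.
Proof.
move=> r0 zr; apply: exp_sq_le_moment => [|s].
  by apply: measurable_funM => //; exact: measurable_dotl.
rewrite -expr_div_n -real_normK ?num_real // lerXn2r ?nnegrE //.
  by rewrite divr_ge0 ?enorm_ge0 // ltW.
rewrite normrM normfV (gtr0_norm (mulr_gt0 r0 B_gt0)) ler_pdivrMr ?mulr_gt0 //.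
rewrite mulrCA divfK ?gt_eqF // mulrC (le_trans (cauchy_schwarz_abs _ _)) //.
by rewrite ler_wpM2l // enorm_ge0.
Qed.

Lemma integrable_dotl z : D.-integrable setT (EFin \o (fun s => dot (g s) z)).
Proof.
(* The added 1 keeps the radius positive when [z = 0]. *)
have r0 : 0 < enorm z + 1 by rewrite ltr_pwDr // enorm_ge0.
have zr : enorm z <= enorm z + 1 by rewrite lerDl.
have mX : measurable_fun setT (fun s => dot (g s) z / ((enorm z + 1) * B)).
  by apply: measurable_funM => //; exact: measurable_dotl.
have [Xi _] := exp_sq_moment mX (moment_dot_sq r0 zr).
have [ai _] := Rintegral_affine 0 ((enorm z + 1) * B) Xi.
rewrite (_ : (fun s => _) = fun s => 0 + (enorm z + 1) * B *
   (dot (g s) z / ((enorm z + 1) * B))) //.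
apply/funext => s; rewrite add0r mulrC divfK //.
by rewrite mulf_neq0 // gt_eqF.
Qed.

Lemma dot_mean_vector z :
  dot (mean_vector D g) z = \int[D]_s dot (g s) z.
Proof.
have ci i : D.-integrable setT (EFin \o (fun s => g s ord0 i)).
  rewrite (_ : (fun s => _) = fun s => dot (g s) (delta_mx ord0 i)).
    exact: integrable_dotl.
  apply/funext => s; rewrite /dot (bigD1 i) //= mxE !eqxx mulr1 big1 ?addr0 //.
  by move=> j ji; rewrite mxE (negbTE ji) andbF mulr0.
apply: EFin_inj; rewrite -EFin_Rintegral; last exact: integrable_dotl.
rewrite /dot; under eq_integral do rewrite -sumEFin.
rewrite integral_sum // => [|i]; last exact: (integrableZr _ _ (ci i)).
rewrite -sumEFin; apply: eq_bigr => i _.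
rewrite mxE EFinM -EFin_Rintegral // -integralZr //; exact: ci.
Qed.

(** The mean [v] is tested against itself: [<g, v> / (|v| B)] has expectation [|v| / B], which
    [exp_sq_moment] bounds by 1. *)
Lemma enorm_mean_vector : enorm (mean_vector D g) <= B.
Proof.
set v := mean_vector D g.
have [v0|v0] := eqVneq (enorm v) 0; first by rewrite v0 ltW.
have vp : 0 < enorm v by rewrite lt_def v0 enorm_ge0.
have mX : measurable_fun setT (fun s => dot (g s) v / (enorm v * B)).
  by apply: measurable_funM => //; exact: measurable_dotl.
have [_] := exp_sq_moment mX (moment_dot_sq vp (lexx _)).
rewrite RintegralZr // -?dot_mean_vector; last exact: integrable_dotl.
rewrite -/v -enorm_sqr ler_pdivrMr ?mulr_gt0 // mul1r expr2.
by rewrite ler_pM2l.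
Qed.

Lemma centered_dot_exp_moment (z : 'rV[R]_n) (r s k : R) : 0 < r ->
  enorm z <= r -> 0 <= s ->
  (s ^+ 2 <= 3^-1 /\ k = 3 / 2) \/ k = 4 ->
  let Y x := expR (s * (dot (mean_vector D g - g x) z / (r * B)) - k * s ^+ 2) in
  D.-integrable setT (EFin \o Y) /\ \int[D]_x Y x <= 1.
Proof.
move=> r0 zr s0 sk Y.
have mX : measurable_fun setT (fun s => dot (g s) z / (r * B)).
  by apply: measurable_funM => //; exact: measurable_dotl.
have := centered_exp_moment mX (moment_dot_sq r0 zr) s0 sk.
rewrite RintegralZr //; last exact: integrable_dotl.
rewrite -dot_mean_vector (_ : (fun x => _) = Y) //.
by apply/funext => x; rewrite /Y dotDl dotNl mulrBl.
Qed.

End VectorMoments.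

Section StepMoment.
Context {R : realType} {dT : measure_display} {T : measurableType dT}.
Variables (D : probability T R) (d n : nat).
Variables (gx : T -> 'rV[R]_d) (gy : T -> 'rV[R]_n) (B1 B2 : R).
Hypotheses (mgx : forall i, measurable_fun setT (fun s => gx s ord0 i))
  (mgy : forall i, measurable_fun setT (fun s => gy s ord0 i)).
Hypotheses (B1_gt0 : 0 < B1) (B2_gt0 : 0 < B2)
  (ex : (\int[D]_s (expR (enorm (gx s) ^+ 2 / B1 ^+ 2))%:E <= (expR 1)%:E)%E)
  (ey : (\int[D]_s (expR (enorm (gy s) ^+ 2 / B2 ^+ 2))%:E <= (expR 1)%:E)%E).

(* The exponent is the convex combination, with weights [1/4], [1/4],
   [B1 / (2 (B1 + B2))] and [B2 / (2 (B1 + B2))], of four exponents each of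
   which has exponential moment at most [1]. *)
Lemma step_exp_moment (zx : 'rV[R]_d) (zy : 'rV[R]_n) (r th c k : R) :
  0 < r -> enorm zx <= r -> enorm zy <= r -> 0 <= th <= 12^-1 -> 0 <= c ->
  let s := 2 * th * c * r * (B1 + B2) in
  (s ^+ 2 <= 3^-1 /\ k = 3 / 2) \/ k = 4 ->
  (\int[D]_x (expR (th * (3 * (enorm (gx x) ^+ 2 / B1 ^+ 2) +
      3 * (enorm (gy x) ^+ 2 / B2 ^+ 2) +
      c * (dot (mean_vector D gx - gx x) zx + dot (mean_vector D gy - gy x) zy))
      - (6 * th + k * s ^+ 2 / 2)))%:E <= 1)%E.
Proof.
move=> r0 zxr zyr /andP[th0 th1] c0 s sk.
have b0 : 0 < B1 + B2 by rewrite addr_gt0.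
have s0 : 0 <= s by rewrite /s !mulr_ge0 // ltW.
have t01 : 0 <= 12 * th <= 1 by move: th0 th1; lra.
have mU : measurable_fun setT (fun x => enorm (gx x) ^+ 2 / B1 ^+ 2).
  by apply: measurable_funM => //; apply: measurable_funX; exact: measurable_enorm.
have mV : measurable_fun setT (fun x => enorm (gy x) ^+ 2 / B2 ^+ 2).
  by apply: measurable_funM => //; apply: measurable_funX; exact: measurable_enorm.
have [i1 e1] := exp_moment_power mU ex t01.
have [i2 e2] := exp_moment_power mV ey t01.
have [i3 e3] := centered_dot_exp_moment mgx B1_gt0 ex r0 zxr s0 sk.
have [i4 e4] := centered_dot_exp_moment mgy B2_gt0 ey r0 zyr s0 sk.
set f1 := (fun x => expR _) in i1; set f2 := (fun x => expR _) in i2.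
set f3 := (fun x => expR _) in i3; set f4 := (fun x => expR _) in i4.
rewrite -/f1 in e1; rewrite -/f2 in e2; rewrite -/f3 in e3; rewrite -/f4 in e4.
pose p := B1 / (B1 + B2) / 2; pose q := B2 / (B1 + B2) / 2.
have p0 : 0 <= p by rewrite /p !divr_ge0 // ltW.
have q0 : 0 <= q by rewrite /q !divr_ge0 // ltW.
have pq : 4^-1 + 4^-1 + p + q = 1.
  by rewrite /p /q; field; rewrite gt_eqF.
pose f x := 4^-1 * f1 x + 4^-1 * f2 x + p * f3 x + q * f4 x.
have I1 : D.-integrable setT (EFin \o (fun x => 4^-1 * f1 x)).
  exact: (integrableZl _ _ i1).
have I2 : D.-integrable setT (EFin \o (fun x => 4^-1 * f2 x)).
  exact: (integrableZl _ _ i2).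
have I3 : D.-integrable setT (EFin \o (fun x => p * f3 x)).
  exact: (integrableZl _ _ i3).
have I4 : D.-integrable setT (EFin \o (fun x => q * f4 x)).
  exact: (integrableZl _ _ i4).
have I12 : D.-integrable setT (EFin \o (fun x => 4^-1 * f1 x + 4^-1 * f2 x)).
  exact: (integrableD _ I1 I2).
have I123 : D.-integrable setT
    (EFin \o (fun x => 4^-1 * f1 x + 4^-1 * f2 x + p * f3 x)).
  exact: (integrableD _ I12 I3).
have If : D.-integrable setT (EFin \o f) by exact: (integrableD _ I123 I4).
have Ef : \int[D]_x f x <= 1.
  rewrite /f RintegralD // RintegralD // RintegralD // !RintegralZl //.
  by have := ler_wpM2l p0 e3; have := ler_wpM2l q0 e4; move: e1 e2 pq; lra.
apply: (@le_trans _ _ (\int[D]_x (f x)%:E)%E); last first.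
  by rewrite EFin_Rintegral // lee_fin.
apply: ge0_le_integral => //.
- apply/measurable_EFinP/measurableT_comp => //; apply: measurable_funB => //.
  apply: measurable_funM => //; apply: measurable_funD.
    by apply: measurable_funD; exact: measurable_funM.
  apply: measurable_funM => //; apply: measurable_funD.
    under eq_fun do rewrite dotDl dotNl.
    by apply: measurable_funB => //; exact: measurable_dotl.
  under eq_fun do rewrite dotDl dotNl.
  by apply: measurable_funB => //; exact: measurable_dotl.
- by move/integrableP : If => [].
move=> x _; rewrite lee_fin.
apply: le_trans (expR_conv4 _ _ _ _ _ _ _ _ pq) => //.
rewrite le_eqVlt; apply/orP; left; apply/eqP; congr expR.
rewrite /p /q /s; field.
by rewrite !gt_eqF.
Qed.

End StepMoment.

(** * Measurability *)

Section CoordMeasurable.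
Context {R : realType} {dT : measure_display} {T : measurableType dT}.

(** Coordinates reduce vector arithmetic to measurable real functions; [measurable_borelRV] returns
    to the Borel structure in which the oracle is measurable. The source [T] is arbitrary so that it
    can also be a history. *)
Definition coord_measurable (n : nat) (h : T -> 'rV[R]_n) :=
  forall i, measurable_fun setT (fun t => h t ord0 i).

Lemma coord_measurable_cst n (v : 'rV[R]_n) : coord_measurable (fun=> v).
Proof. by move=> i; exact: measurable_cst. Qed.

Lemma coord_measurableD n (g h : T -> 'rV[R]_n) : coord_measurable g ->
  coord_measurable h -> coord_measurable (fun t => g t + h t).
Proof.
move=> mg mh i; under eq_fun do rewrite mxE.
exact: (measurable_funD (mg i) (mh i)).
Qed.

Lemma coord_measurableZ n (a : R) (h : T -> 'rV[R]_n) :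
  coord_measurable h -> coord_measurable (fun t => a *: h t).
Proof.
move=> mh i; under eq_fun do rewrite mxE.
exact: (measurable_funM (measurable_cst a) (mh i)).
Qed.

Lemma coord_measurableN n (h : T -> 'rV[R]_n) :
  coord_measurable h -> coord_measurable (fun t => - h t).
Proof.
by move=> mh; under eq_fun do rewrite -scaleN1r; exact: coord_measurableZ.
Qed.

Lemma coord_measurableB n (g h : T -> 'rV[R]_n) : coord_measurable g ->
  coord_measurable h -> coord_measurable (fun t => g t - h t).
Proof. by move=> mg mh; apply: coord_measurableD => //; exact: coord_measurableN. Qed.

Lemma coord_measurable_sum n (I : Type) (r : seq I) (h : I -> T -> 'rV[R]_n) :
  (forall i, coord_measurable (h i)) ->
  coord_measurable (fun t => \sum_(i <- r) h i t).
Proof.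
move=> mh; elim: r => [|i r IH].
  by under eq_fun do rewrite big_nil; exact: coord_measurable_cst.
by under eq_fun do rewrite big_cons; exact: coord_measurableD.
Qed.

Lemma coord_measurable_row_mx n p (g : T -> 'rV[R]_n) (h : T -> 'rV[R]_p) :
  coord_measurable g -> coord_measurable h ->
  coord_measurable (fun t => row_mx (g t) (h t)).
Proof.
move=> mg mh i; under eq_fun do rewrite mxE.
by case: (fintype.split i) => j; [exact: mg|exact: mh].
Qed.

(** The open set is the union of the countably many [enorm] balls with rational centre and radius
    [1 / (k + 1)] that it contains; the preimage of each ball is measurable as a sublevel set of a
    distance. *)
Lemma measurable_preimage_open n (h : T -> 'rV[R]_n) (O : set 'rV[R]_n) :
  coord_measurable h -> open O -> measurable (h @^-1` O).
Proof.
move=> mh oO.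
pose B (qk : 'rV[rat]_n * nat) : set 'rV[R]_n :=
  [set x | enorm (x - map_mx ratr qk.1) < qk.2.+1%:R^-1].
have -> : h @^-1` O = \bigcup_qk (if `[< B qk `<=` O >] then h @^-1` (B qk) else set0).
  apply/seteqP; split=> [t Ot|t [qk _]]; last first.
    by case: asboolP => // BO /BO.
  have /nbhs_ballP[e /= e0 eO] := open_nbhs_nbhs (conj oO Ot).
  (* The factor 2 is for the ball around the rational point: it contains [h t] and must stay within
     [e] of it. *)
  have [k ke] : exists k : nat, 2 * k.+1%:R^-1 < e.
    have [k _ hk] := near_infty_natSinv_lt (PosNum (divr_gt0 e0 (ltr0n _ 2))).
    by exists k; rewrite mulrC -ltr_pdivlMr //; exact: (hk k (leqnn k)).
  (* Coordinatewise precision [1 / ((k + 1) c)] becomes [enorm] precision below [1 / (k + 1)]; the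
     added 1 handles [n = 0]. *)
  pose c : R := Num.sqrt n%:R + 1.
  have c0 : 0 < c by rewrite ltr_pwDr // sqrtr_ge0.
  have /choice[q qh] i : exists q : rat,
      `|h t ord0 i - ratr q| < k.+1%:R^-1 / c.
    have d0 : 0 < k.+1%:R^-1 / c by rewrite divr_gt0 // invr_gt0 ltr0n.
    move: (k.+1%:R^-1 / c) (h t ord0 i) d0 => dl x d0.
    have [|q] := @rat_in_itvoo R (x - dl) (x + dl).
      by rewrite ltrD2l gt0_cp.
    rewrite in_itv /= => /andP[q1 q2]; exists q; rewrite ltr_norml; apply/andP; split; lra.
  have k0 : 0 < k.+1%:R^-1 :> R by rewrite invr_gt0 ltr0n.
  have Bt : B (\row_i q i, k) (h t).
    rewrite /B /=; apply: (le_lt_trans (enorm_le_norm _)).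
    apply: (@le_lt_trans _ _ (Num.sqrt n%:R * (k.+1%:R^-1 / c))).
      rewrite ler_wpM2l ?sqrtr_ge0 // /Num.norm /= mx_normrE.
      apply/bigmax_leP; split => [|[i j] _ /=]; first by rewrite divr_ge0 // ltW.
      by rewrite (ord1 i) !mxE ltW.
    by rewrite mulrCA gtr_pMr // ltr_pdivrMr // mul1r ltrDl.
  exists (\row_i q i, k) => //; case: asboolP => // -[] x /= Bx.
  apply: eO; rewrite -ball_normE /ball_ /=.
  apply: (le_lt_trans (norm_le_enorm _)); apply: lt_trans ke.
  apply: (le_lt_trans (enorm_triangle _ (map_mx ratr (\row_i q i)) _)).
  by rewrite mulr_natl mulr2n ltrD // enormBC.
apply: countable_bigcupT_measurable => // qk.
case: ifP => // _.
have mF : measurable_fun setT (fun t => enorm (h t - map_mx ratr qk.1)).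
  by apply: measurable_enorm; exact: (coord_measurableB mh (coord_measurable_cst _)).
have := mF measurableT _ (measurable_itv `]-oo, qk.2.+1%:R^-1[).
by rewrite setTI.
Qed.

Lemma measurable_preimage_closed n (h : T -> 'rV[R]_n) (C : set 'rV[R]_n) :
  coord_measurable h -> closed C -> measurable (h @^-1` C).
Proof.
move=> mh cC; rewrite -[C]setCK preimage_setC; apply: measurableC.
exact: (measurable_preimage_open mh (closed_openC cC)).
Qed.

Lemma measurable_borelRV n (h : T -> 'rV[R]_n) :
  coord_measurable h -> measurable_fun setT (h : T -> borelRV R n).
Proof.
move=> mh; apply: (@measurability _ _ T (borelRV R n) setT h (@open 'rV[R]_n) erefl).
move=> _ [V oO <-]; rewrite setTI.
exact: (measurable_preimage_open mh oO).
Qed.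

Lemma measurable_within_continuous n (h : T -> 'rV[R]_n) (A : set 'rV[R]_n)
    (f : 'rV[R]_n -> R) :
  coord_measurable h -> (forall t, A (h t)) -> {within A, continuous f} ->
  measurable_fun setT (f \o h).
Proof.
move=> mh Ah cf; apply: (measurability _ (RGenOpens.measurableE R)).
move=> _ [_ [a [b ->] <-]]; rewrite setTI.
have /open_subspaceP[V oV VE] := (continuousP _).1 cf `]a, b[%classic (itv_open _ _).
rewrite (_ : _ @^-1` _ = h @^-1` V); first exact: (measurable_preimage_open mh oV).
apply/seteqP; split => t /= ft.
- have : (f @^-1` `]a, b[ `&` A) (h t) by split.
  by rewrite -VE => -[].
- have : (V `&` A) (h t) by split.
  by rewrite VE => -[].
Qed.

End CoordMeasurable.

Lemma borelRV_coord_measurable (R : realType) n i :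
  measurable_fun setT (fun v : borelRV R n => (v : 'rV[R]_n) ord0 i).
Proof.
apply: (measurability _ (RGenOpens.measurableE R)).
move=> _ [_ [a [b ->] <-]]; rewrite setTI; apply: sub_sigma_algebra.
by apply: open_comp => [v _|]; [exact: coord_continuous|exact: itv_open].
Qed.

Section MeasurableProjection.
Context {R : realType} {dT : measure_display} {T : measurableType dT} {d : nat}.

(** The ball is centred at the random start of an epoch, so regularity is needed jointly in the
    centre and the projected point, here packed into one vector. [proj_ball_modulus] supplies it,
    for centres in [X] at distance at most [r]. *)
Lemma proj_ball_continuous (X : set 'rV[R]_d) (r : R) i :
  closed X -> convex_set X -> 0 < r ->
  {within [set w : 'rV[R]_(d + d) | X (lsubmx w)],
    continuous (fun w => proj (X `&` eball (lsubmx w) r) (rsubmx w) ord0 i)}.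
Proof.
move=> cX vX r0; apply/subspace_continuousP => w0 /= Xw0.
pose g (w : 'rV[R]_(d + d)) := proj (X `&` eball (lsubmx w) r) (rsubmx w).
rewrite -/(g w0); under eq_fun do rewrite -/(g _).
pose C (w : 'rV[R]_(d + d)) := enorm (lsubmx w - lsubmx w0).
pose U (w : 'rV[R]_(d + d)) := enorm (rsubmx w - rsubmx w0).
pose K := 2 * enorm (rsubmx w0 - lsubmx w0).
have cC : continuous C.
  move=> w; exact: (continuous_comp (@continuous_lsubmx R 1 d d w)
    (@continuous_enormB R d (lsubmx w0) (lsubmx w))).
have cU : continuous U.
  move=> w; exact: (continuous_comp (@continuous_rsubmx R 1 d d w)
    (@continuous_enormB R d (rsubmx w0) (rsubmx w))).
(* This majorises the right-hand side of [proj_ball_modulus] after the triangle inequality, is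
   continuous and vanishes at [w0]. *)
pose b2 w := U w * U w + 2 * C w * (U w + C w + K).
pose b w := Num.sqrt (b2 w).
have cb2 : continuous b2.
  move=> w; exact: (cvgD (cvgM (cU w) (cU w)) (cvgM (cvgM (cvg_cst (2 : R)) (cC w))
    (cvgD (cvgD (cU w) (cC w)) (cvg_cst K)))).
have cb : continuous b.
  by move=> w; exact: (continuous_comp (cb2 w) (@sqrt_continuous R _)).
have C0 : C w0 = 0 by rewrite /C subrr enorm0.
have b0 : b w0 = 0.
  by rewrite /b /b2 C0 /U subrr enorm0 !(mulr0, mul0r, addr0) sqrtr0.
apply/cvgrPdist_lt => e e0; rewrite near_withinE; near=> w => Xw.
apply: (@le_lt_trans _ _ (b w)); last first.
  near: w; apply: (cvgr_lt (b w0)); [exact: cb|by rewrite b0].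
have Cr : C w < r.
  near: w; apply: (cvgr_lt (C w0)); [exact: cC|by rewrite C0].
have := coord_le_enorm (g w0 - g w) i; rewrite !mxE; move/le_trans; apply.
rewrite /enorm ler_sqrt; last first.
  by rewrite addr_ge0 ?mulr_ge0 ?addr_ge0 ?enorm_ge0 // /K mulr_ge0 ?enorm_ge0.
have Cr' : enorm (lsubmx w0 - lsubmx w) <= r by rewrite enormBC ltW.
apply: (le_trans (proj_ball_modulus (rsubmx w0) (rsubmx w) cX vX Xw0 Xw r0 Cr')).
rewrite (enormBC (rsubmx w0) (rsubmx w)) (enormBC (lsubmx w0) (lsubmx w)).
rewrite -/(U w) -/(C w) /b2 expr2 lerD2l ler_wpM2l ?mulr_ge0 ?enorm_ge0 //.
have := enorm_triangle (rsubmx w) (rsubmx w0) (lsubmx w).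
have := enorm_triangle (rsubmx w0) (lsubmx w0) (lsubmx w).
by rewrite (enormBC (lsubmx w0) (lsubmx w)) -/(U w) -/(C w) /K; lra.
Unshelve. all: by end_near. Qed.

Lemma measurable_proj_ball (X : set 'rV[R]_d) (r : R) (c u : T -> 'rV[R]_d) :
  closed X -> convex_set X -> 0 < r -> (forall t, X (c t)) ->
  coord_measurable c -> coord_measurable u ->
  coord_measurable (fun t => proj (X `&` eball (c t) r) (u t)).
Proof.
move=> cX vX r0 Xc mc mu i.
have := measurable_within_continuous (coord_measurable_row_mx mc mu) _
  (proj_ball_continuous (i := i) cX vX r0).
have -> : (fun w : 'rV[R]_(d + d) => proj (X `&` eball (lsubmx w) r) (rsubmx w) ord0 i) \o
    (fun t => row_mx (c t) (u t)) = (fun t => proj (X `&` eball (c t) r) (u t) ord0 i).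
  by apply/funext => t /=; rewrite row_mxKl row_mxKr.
by apply => t /=; rewrite row_mxKl.
Qed.

End MeasurableProjection.

Section MeasurableOracle.
Context {R : realType} {d n p : nat} {dXi : measure_display}
  {Xi : measurableType dXi}.
Variables (X : set 'rV[R]_d) (Y : set 'rV[R]_n).
Variable G : 'rV[R]_d -> 'rV[R]_n -> Xi -> 'rV[R]_p.
Hypotheses (cX : closed X) (cY : closed Y) (mG : measurable_oracle X Y G).

Lemma measurable_closed_borelRV k (C : set 'rV[R]_k) : closed C ->
  measurable (C : set (borelRV R k)).
Proof.
move=> cC; rewrite -[C]setCK; apply: measurableC; apply: sub_sigma_algebra.
exact: closed_openC.
Qed.

Lemma coord_measurable_oracle {dT : measure_display} {T : measurableType dT}
    (x : T -> 'rV[R]_d) (y : T -> 'rV[R]_n) (s : T -> Xi) :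
  coord_measurable x -> coord_measurable y -> measurable_fun setT s ->
  (forall t, X (x t)) -> (forall t, Y (y t)) ->
  coord_measurable (fun t => G (x t) (y t) (s t)).
Proof.
move=> mx my ms Xx Yy i.
pose h t : borelRV R d * borelRV R n * Xi := ((x t, y t), s t).
have mh : measurable_fun setT h.
  apply: measurable_fun_pair => //; apply: measurable_fun_pair.
    exact: measurable_borelRV.
  exact: measurable_borelRV.
have mD : measurable (X `*` Y `*` [set: Xi] : set (borelRV R d * borelRV R n * Xi)).
  apply: measurableX => //; apply: measurableX; exact: measurable_closed_borelRV.
move=> _ B mB; rewrite setTI.
have mB' := @borelRV_coord_measurable R p i measurableT B mB.
rewrite setTI in mB'.
have := mh measurableT _ (mG mD mB'); rewrite setTI; congr measurable.
by apply/seteqP; split => t /= => [[_ //]|Bt]; split.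
Qed.

Lemma coord_measurable_mean_vector {dT : measure_display} {T : measurableType dT}
    (D : probability Xi R) (x : T -> 'rV[R]_d) (y : T -> 'rV[R]_n) :
  coord_measurable x -> coord_measurable y ->
  (forall t, X (x t)) -> (forall t, Y (y t)) ->
  coord_measurable (fun t => mean_vector D (G (x t) (y t))).
Proof.
move=> mx my Xx Yy i; under eq_fun do rewrite mxE.
pose F (ts : T * Xi) := (G (x ts.1) (y ts.1) ts.2 ord0 i)%:E.
have mF : measurable_fun setT F.
  apply/measurable_EFinP.
  apply: (coord_measurable_oracle (x := x \o fst) (y := y \o fst) (s := snd)) => //.
  - by move=> j; apply: (measurableT_comp (mx j)).
  - by move=> j; apply: (measurableT_comp (my j)).
  - by move=> ts; exact: Xx.
  - by move=> ts; exact: Yy.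
have mI : measurable_fun setT (fun t => \int[D]_s F (t, s))%E.
  (* Tonelli gives measurability of the parameter integral for the nonnegative positive and negative
     parts separately. *)
  rewrite (_ : (fun t => _) = fun t => (fubini_F D (F^\+)%E t - fubini_F D (F^\-)%E t)%E).
    apply: emeasurable_funB.
      apply: measurable_fun_fubini_tonelli_F; first exact: measurable_funepos.
      by move=> ts; exact: funepos_ge0.
    apply: measurable_fun_fubini_tonelli_F; first exact: measurable_funeneg.
    by move=> ts; exact: funeneg_ge0.
  apply/funext => t; rewrite integralE /fubini_F /=.
  by congr (_ - _)%E; apply: eq_integral => s _; rewrite ?funeposE ?funenegE.
exact: (measurableT_comp (fine_measurable measurableT) mI).
Qed.

End MeasurableOracle.

(** * The duality gap and its sublevel sets *)

Section Gap.
Context {R : realType} {d n : nat} (X : set 'rV[R]_d) (Y : set 'rV[R]_n)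
  (f : 'rV[R]_d -> 'rV[R]_n -> R).

(** Non-emptiness makes the supremum differ from [-oo] and the infimum from [+oo], which excludes
    the ill-defined differences; either bound then makes both finite. *)
Lemma gap_leP (x : 'rV[R]_d) (y : 'rV[R]_n) (c : R) : X !=set0 -> Y !=set0 ->
  (gap X Y f x y <= c%:E)%E <->
  forall x' y', X x' -> Y y' -> f x y' - f x' y <= c.
Proof.
move=> [a Xa] [b Yb]; rewrite /gap.
set S := ereal_sup _; set I := ereal_inf _.
have Sb : (-oo < S)%E.
  rewrite (@lt_le_trans _ _ (f x b)%:E) ?ltNyr //; apply: ereal_sup_ubound.
  by exists b.
have Ia : (I < +oo)%E.
  rewrite (@le_lt_trans _ _ (f a y)%:E) ?ltry //; apply: ereal_inf_lbound.
  by exists a.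
split=> [h x' y' Xx' Yy'|h].
  rewrite -lee_fin EFinB; apply: le_trans h; apply: leeB.
    by apply: ereal_sup_ubound; exists y'.
  by apply: ereal_inf_lbound; exists x'.
have {}h x' : X x' -> (S <= (c + f x' y)%:E)%E.
  move=> Xx'; apply: ge_ereal_sup => _ [y' Yy' <-].
  by rewrite lee_fin -lerBlDr h.
have Sfin : S \is a fin_num.
  by rewrite fin_real // Sb (le_lt_trans (h _ Xa)) // ltry.
rewrite leeBlDr //; last first.
  rewrite fin_real // Ia andbT; apply: (@lt_le_trans _ _ (S - c%:E)%E).
    by rewrite -(fineK Sfin) -EFinB ltNyr.
  apply: le_ereal_inf_tmp => _ [x' Xx' <-].
  by rewrite leeBlDr // -EFinD addrC h.
rewrite addeC -leeBlDr //; apply: le_ereal_inf_tmp => _ [x' Xx' <-].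
by rewrite leeBlDr // -EFinD addrC h.
Qed.

Hypotheses (cX : closed X) (cY : closed Y)
  (cf : {within X `*` Y, continuous (fun z => f z.1 z.2)}).

(** An uncountable supremum of measurable functions need not be measurable. Here the sublevel set is
    an intersection of relatively closed sets of the closed set [X * Y], one for each pair of
    competitors, hence closed. *)
Lemma measurable_gap_le {dT : measure_display} {T : measurableType dT}
    (x : T -> 'rV[R]_d) (y : T -> 'rV[R]_n) (c : R) :
  coord_measurable x -> coord_measurable y ->
  (forall t, X (x t)) -> (forall t, Y (y t)) -> X !=set0 -> Y !=set0 ->
  measurable [set t | (gap X Y f (x t) (y t) <= c%:E)%E].
Proof.
move=> mx my Xx Yy X0 Y0.
pose A : set 'rV[R]_(d + n) := [set w | X (lsubmx w) /\ Y (rsubmx w)].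
have cA : closed A.
  apply: closedI.
    by apply: (closed_comp (f := lsubmx)) => // w _; exact: continuous_lsubmx.
  by apply: (closed_comp (f := rsubmx)) => // w _; exact: continuous_rsubmx.
pose S : set 'rV[R]_(d + n) := [set w | A w /\ forall x' y', X x' -> Y y' ->
  f (lsubmx w) y' - f x' (rsubmx w) <= c].
suff cS : closed S.
  have -> : [set t | (gap X Y f (x t) (y t) <= c%:E)%E] =
      (fun t => row_mx (x t) (y t)) @^-1` S.
    apply/seteqP; split => t /=; rewrite /S /A /= row_mxKl row_mxKr.
      by move=> /(gap_leP _ _ _ X0 Y0).
    by move=> [_ h]; apply/gap_leP.
  exact: (measurable_preimage_closed (coord_measurable_row_mx mx my) cS).
have -> : S = A `&` \bigcap_(z in X `*` Y)
    (A `&` [set w | f (lsubmx w) z.2 - f z.1 (rsubmx w) <= c]).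
  apply/seteqP; split => w [Aw h]; split => //.
    by move=> [x' y'] [/= Xx' Yy']; split => //; exact: h.
  by move=> x' y' Xx' Yy'; have [] := h (x', y') (conj Xx' Yy').
apply: closedI => //; apply: closed_bigI => -[x' y'] [/= Xx' Yy'].
have cg : {within A, continuous (fun w => f (lsubmx w) y' - f x' (rsubmx w))}.
  apply/subspace_continuousP => w [Xw Yw].
  have cont (a : 'rV[R]_(d + n) -> 'rV[R]_d) (b : 'rV[R]_(d + n) -> 'rV[R]_n) :
      continuous a -> continuous b -> (forall v, A v -> X (a v) /\ Y (b v)) ->
      f (a v) (b v) @[v --> within A (nbhs w)] --> f (a w) (b w).
    move=> ca cb Aab.
    have /subspace_continuousP /(_ (a w, b w)) := cf.
    move=> /(_ (Aab _ (conj Xw Yw))) /= h B hB.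
    have cab : (a v, b v) @[v --> w] --> (a w, b w).
      exact: (cvg_pair (ca w) (cb w)).
    change (nbhs w [set v | A v -> B (f (a v) (b v))]).
    exact: (@filterS _ (nbhs w) _ [set v | (X `*` Y) (a v, b v) -> B (f (a v) (b v))] _
      (fun v hv Av => hv (Aab v Av)) (cab _ (h B hB))).
  have cy' : continuous (cst y' : 'rV[R]_(d + n) -> 'rV[R]_n).
    by move=> v; exact: cst_continuous.
  have cx' : continuous (cst x' : 'rV[R]_(d + n) -> 'rV[R]_d).
    by move=> v; exact: cst_continuous.
  have c1 := cont lsubmx _ (@continuous_lsubmx R 1 d n) cy'
    (fun v Av => conj Av.1 Yy').
  have c2 := cont _ rsubmx cx' (@continuous_rsubmx R 1 d n)
    (fun v Av => conj Xx' Av.2).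
  exact: (cvgB c1 c2).
have /closed_subspaceP[V cV VE] := (continuous_closedP _).1 cg _ (@closed_le R c).
rewrite (_ : _ `&` _ = V `&` A); first exact: closedI.
by rewrite VE setIC.
Qed.

End Gap.

(** * Independence of a fresh sample from the past *)

Section Freshness.
Context {R : realType} {dO dXi : measure_display} {Omega : measurableType dO}
  {Xi : measurableType dXi} {I : choiceType}.
Variables (P : probability Omega R) (D : probability Xi R) (Z : I -> {RV P >-> Xi}).
Hypotheses (Z_law : forall i (A : set Xi), measurable A -> P (Z i @^-1` A) = D A)
  (Z_indep : mutually_independent Z).

(** Events fixed by finitely many samples with index in [S]. They form a family stable under
    intersection, as uniqueness of measures requires. *)
Definition cylinder (S : set I) : set (set Omega) :=
  [set E | exists (J : {fset I}) (A : I -> set Xi),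
    [/\ forall i, measurable (A i), [set` J] `<=` S &
        E = \bigcap_(i in [set` J]) (Z i @^-1` A i)]].

(** The set [Omega] with the smaller sigma-algebra generated by the samples in [S]: measurability
    from [history S] expresses dependence on these samples only. *)
Definition history (S : set I) := g_sigma_algebraType (cylinder S).

Lemma measurable_preimage_sample i (A : set Xi) :
  measurable A -> measurable (Z i @^-1` A).
Proof.
by move=> mA; rewrite -[X in measurable X]setTI; exact: (measurable_funPT (Z i)).
Qed.

Lemma cylinder_measurable S : cylinder S `<=` measurable.
Proof.
move=> _ [J [A [mA _ ->]]]; apply: fin_bigcap_measurable => // i _.
exact: measurable_preimage_sample.
Qed.

Lemma cylinder_setT S : cylinder S setT.
Proof.
exists fset0, (fun=> setT); split => //.
by apply/seteqP; split => w // _ i /=; rewrite inE.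
Qed.

Lemma cylinder_setI S : setI_closed (cylinder S).
Proof.
move=> _ _ [J1 [A1 [mA1 S1 ->]]] [J2 [A2 [mA2 S2 ->]]].
exists (J1 `|` J2)%fset, (fun i => (if i \in J1 then A1 i else setT) `&`
  (if i \in J2 then A2 i else setT)); split.
- by move=> i; apply: measurableI; case: ifP.
- by move=> i /=; rewrite in_fsetU => /orP[/S1|/S2].
apply/seteqP; split => w /=.
  move=> [h1 h2] i _ /=; split.
    by case: ifP => // iJ; exact: (h1 i iJ).
  by case: ifP => // iJ; exact: (h2 i iJ).
move=> h; split => i iJ.
  by have /= := h i; rewrite in_fsetU iJ => /(_ isT) [].
by have /= := h i; rewrite in_fsetU iJ orbT => /(_ isT) [].
Qed.

Lemma history_measurable S (A : set (history S)) :
  measurable A -> measurable (A : set Omega).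
Proof.
by apply: smallest_sub; [exact: sigma_algebra_measurable|exact: cylinder_measurable].
Qed.

Lemma measurable_history_id S :
  measurable_fun setT (fun w : Omega => w : history S).
Proof.
by move=> _ A mA; rewrite setTI preimage_id; exact: history_measurable.
Qed.

Lemma measurable_fun_historyW {dT : measure_display} {T : measurableType dT}
    (S S' : set I) (h : Omega -> T) : S `<=` S' ->
  measurable_fun setT (h : history S -> T) -> measurable_fun setT (h : history S' -> T).
Proof.
move=> SS' mh _ B mB; have := mh measurableT B mB; rewrite !setTI.
apply: sub_sigma_algebra2 => _ [J [A [mA JS ->]]].
by exists J, A; split => //; exact: subset_trans SS'.
Qed.

Lemma measurable_sample S i : S i ->
  measurable_fun setT (fun w : history S => Z i w).
Proof.
move=> Si _ B mB; rewrite setTI; apply: sub_sigma_algebra.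
exists [fset i]%fset, (fun=> B); split => //.
  by move=> j /=; rewrite inE => /eqP ->.
apply/seteqP; split => w /=.
  by move=> Bw j /=; rewrite inE => /eqP ->.
by move=> h; apply: (h i); rewrite /= inE.
Qed.

(** Both sides are finite measures in [A]. They agree on cylinders by mutual independence, and
    therefore on the generated sigma-algebra. *)
Lemma history_indep S j (A : set Omega) (B : set Xi) : ~ S j ->
  <<s cylinder S >> A -> measurable B ->
  (P (A `&` Z j @^-1` B) = P A * D B)%E.
Proof.
move=> Sj sA mB; have mZB := measurable_preimage_sample j mB.
have DB : D B \is a fin_num by exact: fin_num_measure.
have DB0 : 0 <= fine (D B) by exact: fine_ge0.
have -> : (P A * D B)%E = mscale (NngNum DB0) P A.
  by rewrite /mscale /= fineK // muleC.
rewrite -/(mrestr P mZB A).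
apply: (g_sigma_algebra_measure_unique (cylinder S) (@cylinder_measurable S)
  (fun=> setT)) sA => //.
- by move=> k; exact: cylinder_setT.
- by rewrite bigcup_const //; exists 0%N.
- exact: cylinder_setI.
- move=> _ [J [C [mC JS ->]]].
  have jJ : j \notin J by apply/negP => jJ; exact: Sj (JS j jJ).
  set E := \bigcap_(i in _) _.
  change (P (E `&` Z j @^-1` B) = (fine (D B))%:E * P E)%E; rewrite fineK // {}/E.
  (* As [j] lies outside [J], the intersection with the new event is again a cylinder, over [J]
     enlarged by [j]. *)
  pose C' i := if i == j then B else C i.
  have eqC i : i \in J -> C' i = C i.
    by move=> iJ; rewrite /C'; case: eqP => // ij; move: jJ; rewrite -ij iJ.
  have -> : \bigcap_(i in [set` J]) (Z i @^-1` C i) `&` Z j @^-1` B =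
      \bigcap_(i in [set` (j |` J)%fset]) (Z i @^-1` C' i).
    apply/seteqP; split => w /=.
      move=> [h hB] i /=; rewrite in_fset1U => /orP[/eqP ->|iJ].
        by rewrite /C' eqxx.
      by rewrite eqC //; exact: (h i iJ).
    move=> h; split.
      by move=> i iJ; rewrite /= -eqC //; apply: (h i); rewrite /= in_fset1U iJ orbT.
    by have := h j; rewrite /= in_fset1U eqxx /C' eqxx => /(_ isT).
  rewrite Z_indep; last by move=> i; rewrite /C'; case: ifP.
  rewrite big_fsetU1 //= [in LHS]/C' eqxx Z_law // Z_indep //.
  congr (_ * _)%E; rewrite big_seq [RHS]big_seq; apply: eq_bigr => i iJ.
  by rewrite -/(C' i) eqC.
- by move=> k; rewrite /mrestr (le_lt_trans (probability_le1 _ _)) ?ltry // setTI.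
Qed.

(** The freezing lemma: by [history_indep] the joint law of past and fresh sample is a product, so
    Tonelli integrates the sample out with the past held fixed. It stands in for conditional
    expectations. *)
Lemma fresh_integral S j (phi : history S * Xi -> \bar R) : ~ S j ->
  measurable_fun setT phi -> (forall z, (0 <= phi z)%E) ->
  (\int[P]_w phi (w, Z j w) = \int[P]_w \int[D]_s phi (w, s))%E.
Proof.
move=> Sj mphi phi0.
have mid := @measurable_history_id S.
have mpair : measurable_fun setT (fun w : Omega => ((w : history S), Z j w)).
  by apply: measurable_fun_pair => //; exact: measurable_funPT.
pose idm : {RV P >-> history S} := mfun_Sub (mem_set mid).
pose pairm : {RV P >-> (history S * Xi)%type} := mfun_Sub (mem_set mpair).
transitivity (\int[distribution P pairm]_z phi z)%E.
  by rewrite ge0_integral_distribution.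
transitivity (\int[distribution P idm \x D]_z phi z)%E.
  apply: eq_measure_integral => A mA _; apply/esym.
  apply: (product_measure_unique (m' := distribution P pairm)) => // B C mB mC.
  exact: (history_indep Sj mB mC).
rewrite fubini_tonelli1 // ge0_integral_distribution //.
  exact: measurable_fun_fubini_tonelli_F.
by move=> w; exact: integral_ge0.
Qed.

End Freshness.

(** * Deterministic analysis of one epoch *)

Section GhostRegret.
Context {R : realType} {d : nat}.

(* The ghost sequence [v] is driven by the noise alone, hence it does not depend
   on the competitor [x]; this makes the last sum a martingale. *)
Lemma ghost_regret (C : set 'rV[R]_d) (eta r B : R) (u v h g : nat -> 'rV[R]_d)
    (x : 'rV[R]_d) (n : nat) :
  closed C -> convex_set C -> C x -> 0 < eta -> 0 <= B ->
  enorm (u 0%N - x) <= r -> v 0%N = u 0%N -> (forall t, enorm (g t) <= B) ->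
  (forall t, u t.+1 = proj C (u t - eta *: h t)) ->
  (forall t, v t.+1 = proj C (v t - eta *: (g t - h t))) ->
  \sum_(t < n) dot (g t) (u t - x) <= r ^+ 2 / eta + n%:R * (eta * B ^+ 2) +
    \sum_(t < n) (3 * eta / 2 * enorm (h t) ^+ 2 + dot (g t - h t) (u t - v t)).
Proof.
move=> cC vC Cx e0 B0 ur v0 gB uS vS.
have h1 := regret_bound n cC vC Cx e0 uS.
have h2 := regret_bound n cC vC Cx e0 vS.
rewrite v0 in h2.
have ur2 : dot (u 0%N - x) (u 0%N - x) <= r ^+ 2.
  by rewrite -enorm_le // (le_trans (enorm_ge0 _) ur).
have dr : dot (u 0%N - x) (u 0%N - x) / (2 * eta) <= r ^+ 2 / eta / 2.
  rewrite -mulrA -invfM (mulrC eta) ler_pM2r // invr_gt0 mulr_gt0 //.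
(* The noise paired with the competitor becomes the regret of the ghost descent; what remains pairs
   it with [u t - v t], which is fixed before the sample at [t] is drawn. *)
have -> : \sum_(t < n) dot (g t) (u t - x) = \sum_(t < n) dot (h t) (u t - x) +
    \sum_(t < n) dot (g t - h t) (v t - x) + \sum_(t < n) dot (g t - h t) (u t - v t).
  rewrite -!big_split; apply: eq_bigr => t _ /=.
  move: (u t) (v t) (g t) (h t) => a b c e; rewrite !dotE; ring.
(* By [|g - h|^2 <= 2 |g|^2 + 2 |h|^2] the ghost costs [eta |h|^2] per step; with [eta / 2] from the
   true descent this gives the coefficient [3 eta / 2]. *)
have h3 : eta / 2 * \sum_(t < n) dot (g t - h t) (g t - h t) <=
    n%:R * (eta * B ^+ 2) + \sum_(t < n) eta * dot (h t) (h t).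
  rewrite mulr_sumr -[X in X%:R * _](card_ord n) mulr_natl -sumr_const -big_split /=.
  apply: ler_sum => t _.
  have gB2 : dot (g t) (g t) <= B ^+ 2 by rewrite -enorm_le.
  have : dot (g t - h t) (g t - h t) <= 2 * B ^+ 2 + 2 * dot (h t) (h t).
    apply: (@le_trans _ _ (2 * dot (g t) (g t) + 2 * dot (h t) (h t))); last lra.
    have := dot_ge0 (g t + h t); rewrite !dotE (dotC (h t) (g t)); lra.
  move/(ler_wpM2l (ltW (divr_gt0 e0 (ltr0n _ 2)))); lra.
have h4 : \sum_(t < n) (3 * eta / 2 * enorm (h t) ^+ 2 + dot (g t - h t) (u t - v t)) =
    eta / 2 * \sum_(t < n) dot (h t) (h t) + \sum_(t < n) eta * dot (h t) (h t) +
    \sum_(t < n) dot (g t - h t) (u t - v t).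
  rewrite mulr_sumr -!big_split; apply: eq_bigr => t _ /=.
  by rewrite enorm_sqr; congr (_ + _); field.
rewrite h4; lra.
Qed.

End GhostRegret.

Section Epoch.
Context {R : realType} {d n : nat} {dXi : measure_display} {Xi : measurableType dXi}.
Variables (X : set 'rV[R]_d) (Y : set 'rV[R]_n) (f : 'rV[R]_d -> 'rV[R]_n -> R).
Variables (D : probability Xi R).
Variables (Gx : 'rV[R]_d -> 'rV[R]_n -> Xi -> 'rV[R]_d)
  (Gy : 'rV[R]_d -> 'rV[R]_n -> Xi -> 'rV[R]_n).
Variable p : epoch_params R.
Let r := radius p.

Definition noise_x (z : 'rV[R]_d * 'rV[R]_n) (s : Xi) :=
  mean_vector D (Gx z.1 z.2) - Gx z.1 z.2 s.
Definition noise_y (z : 'rV[R]_d * 'rV[R]_n) (s : Xi) :=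
  mean_vector D (Gy z.1 z.2) - Gy z.1 z.2 s.

(* The ascending player performs descent on [- f (x, .)], so its noise enters
   with the opposite sign. *)
Fixpoint ghost_iterate (z0 : 'rV[R]_d * 'rV[R]_n) (s : nat -> Xi) (t : nat) :
    'rV[R]_d * 'rV[R]_n :=
  if t is t'.+1 then
    let z := inner_iterate X Y Gx Gy p z0 s t' in
    let g := ghost_iterate z0 s t' in
    (proj (X `&` eball z0.1 r) (g.1 - step_x p *: noise_x z (s t')),
     proj (Y `&` eball z0.2 r) (g.2 + step_y p *: noise_y z (s t')))
  else z0.

Definition noise_sum (z g : 'rV[R]_d * 'rV[R]_n) (s : Xi) : R :=
  dot (noise_x z s) (z.1 - g.1) + dot (noise_y z s) (g.2 - z.2).

Hypotheses (cX : closed X) (vX : convex_set X) (cY : closed Y) (vY : convex_set Y).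
Hypotheses (r_gt0 : 0 < r) (ex_gt0 : 0 < step_x p) (ey_gt0 : 0 < step_y p).
Variables (z0 : 'rV[R]_d * 'rV[R]_n) (s : nat -> Xi).
Hypotheses (Xz0 : X z0.1) (Yz0 : Y z0.2).

Lemma eballxx k (c : 'rV[R]_k) : eball c r c.
Proof. by rewrite /eball /= subrr enorm0 ltW. Qed.

Let BX := X `&` eball z0.1 r.
Let BY := Y `&` eball z0.2 r.
Let cBX : closed BX. Proof. by apply: closedI => //; exact: closed_eball. Qed.
Let cBY : closed BY. Proof. by apply: closedI => //; exact: closed_eball. Qed.
Let vBX : convex_set BX. Proof. by apply: convex_setI => //; exact: eball_convex. Qed.
Let vBY : convex_set BY. Proof. by apply: convex_setI => //; exact: eball_convex. Qed.
Let BX0 : BX z0.1. Proof. by split => //; exact: eballxx. Qed.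
Let BY0 : BY z0.2. Proof. by split => //; exact: eballxx. Qed.

Notation iterate := (inner_iterate X Y Gx Gy p z0 s).
Notation ghost := (ghost_iterate z0 s).

Lemma inner_iterate_in t :
  (X `&` eball z0.1 r) (iterate t).1 /\ (Y `&` eball z0.2 r) (iterate t).2.
Proof.
case: t => [|t] //=; split.
  by have [] := proj_min ((iterate t).1 - step_x p *: Gx (iterate t).1 (iterate t).2 (s t)) cBX BX0.
by have [] := proj_min ((iterate t).2 + step_y p *: Gy (iterate t).1 (iterate t).2 (s t)) cBY BY0.
Qed.

Lemma ghost_iterate_in t :
  (X `&` eball z0.1 r) (ghost t).1 /\ (Y `&` eball z0.2 r) (ghost t).2.
Proof.
case: t => [|t] //=; split.
  by have [] := proj_min ((ghost t).1 - step_x p *: noise_x (iterate t) (s t)) cBX BX0.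
by have [] := proj_min ((ghost t).2 + step_y p *: noise_y (iterate t) (s t)) cBY BY0.
Qed.

Lemma iterate_ghost_dist t : enorm ((iterate t).1 - (ghost t).1) <= 2 * r /\
  enorm ((ghost t).2 - (iterate t).2) <= 2 * r.
Proof.
have [[_ h1] [_ h2]] := inner_iterate_in t.
have [[_ h3] [_ h4]] := ghost_iterate_in t.
split.
  apply: (le_trans (enorm_triangle _ z0.1 _)); rewrite (enormBC z0.1).
  by move: h1 h3; rewrite /eball /=; lra.
apply: (le_trans (enorm_triangle _ z0.2 _)); rewrite (enormBC z0.2).
by move: h2 h4; rewrite /eball /=; lra.
Qed.

Let T := nb_iter p.
Hypothesis T_gt0 : (0 < T)%N.

Notation avg := (epoch_average X Y Gx Gy p z0 s).

Lemma epoch_average_in : X avg.1 /\ Y avg.2.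
Proof.
split.
  apply: (@convex_mean _ _ _ _ (fun t => (iterate t).1)) => // t _.
  by have [[]] := inner_iterate_in t.
apply: (@convex_mean _ _ _ _ (fun t => (iterate t).2)) => // t _.
by have [_ []] := inner_iterate_in t.
Qed.

Hypothesis G_unbiased : unbiased_oracle D X Y f Gx Gy.
Variables (B1 B2 : R).
Hypotheses (B1_ge0 : 0 <= B1) (B2_ge0 : 0 <= B2).
Hypotheses (mean_x : forall x y, X x -> Y y -> enorm (mean_vector D (Gx x y)) <= B1)
  (mean_y : forall x y, X x -> Y y -> enorm (mean_vector D (Gy x y)) <= B2).

(** Jensen's inequality through one subgradient at each average point: the linear terms sum to zero
    because the deviations from the average do. *)
Lemma avg_gap_le x y : X x -> Y y ->
  T%:R * (f avg.1 y - f x avg.2) <=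
  \sum_(t < T) (f (iterate t).1 y - f x (iterate t).2).
Proof.
move=> Xx Yy; have [Xa Ya] := epoch_average_in.
have [sx _] := G_unbiased Xa Yy; have [_ sy] := G_unbiased Xx Ya.
set v := mean_vector _ _ in sx; set w := mean_vector _ _ in sy.
have T0 : (T%:R : R) != 0 by rewrite pnatr_eq0 -lt0n.
have sum0 k (F : nat -> 'rV[R]_k) :
    \sum_(t < T) (F t - T%:R^-1 *: \sum_(t < T) F t) = 0.
  rewrite big_split /= sumr_const card_ord -scaler_nat scalerN scalerA.
  by rewrite mulfV // scale1r subrr.
have -> : T%:R * (f avg.1 y - f x avg.2) = \sum_(t < T)
    ((f avg.1 y + dot v ((iterate t).1 - avg.1)) -
     (f x avg.2 + dot w ((iterate t).2 - avg.2))).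
  rewrite sumrB !big_split /= !sumr_const card_ord.
  under [\sum_(i < T) dot v _]eq_bigr do rewrite dotC.
  under [\sum_(i < T) dot w _]eq_bigr do rewrite dotC.
  rewrite -!dot_suml (sum0 _ (fun t => (iterate t).1)) (sum0 _ (fun t => (iterate t).2)).
  by rewrite !dot0l !addr0 -mulrnBl mulr_natl.
apply: ler_sum => t _; have [[Xt _] [Yt _]] := inner_iterate_in t.
by have := sx _ Xt; have := sy _ Yt; lra.
Qed.

Lemma epoch_regret x y : (X `&` eball z0.1 r) x -> (Y `&` eball z0.2 r) y ->
  T%:R * (f avg.1 y - f x avg.2) <=
  r ^+ 2 / step_x p + r ^+ 2 / step_y p +
  T%:R * (step_x p * B1 ^+ 2 + step_y p * B2 ^+ 2) +
  \sum_(t < T) (3 * step_x p / 2 * enorm (Gx (iterate t).1 (iterate t).2 (s t)) ^+ 2 +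
    3 * step_y p / 2 * enorm (Gy (iterate t).1 (iterate t).2 (s t)) ^+ 2 +
    noise_sum (iterate t) (ghost t) (s t)).
Proof.
move=> Bx By; have [Xx xr] := Bx; have [Yy yr] := By.
apply: (le_trans (avg_gap_le Xx Yy)).
pose mx t := mean_vector D (Gx (iterate t).1 (iterate t).2).
pose my t := mean_vector D (Gy (iterate t).1 (iterate t).2).
pose hx t := Gx (iterate t).1 (iterate t).2 (s t).
pose hy t := Gy (iterate t).1 (iterate t).2 (s t).
have Xt t : X (iterate t).1 by have [[]] := inner_iterate_in t.
have Yt t : Y (iterate t).2 by have [_ []] := inner_iterate_in t.
have kx : \sum_(t < T) dot (mx t) ((iterate t).1 - x) <=
    r ^+ 2 / step_x p + T%:R * (step_x p * B1 ^+ 2) +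
    \sum_(t < T) (3 * step_x p / 2 * enorm (hx t) ^+ 2 +
      dot (mx t - hx t) ((iterate t).1 - (ghost t).1)).
  apply: (@ghost_regret R d BX (step_x p) r B1 (fun t => (iterate t).1)
    (fun t => (ghost t).1) hx mx x T) => //.
  - by move: xr; rewrite /eball /= enormBC.
  - by move=> t; exact: mean_x.
have ky : \sum_(t < T) dot (- my t) ((iterate t).2 - y) <=
    r ^+ 2 / step_y p + T%:R * (step_y p * B2 ^+ 2) +
    \sum_(t < T) (3 * step_y p / 2 * enorm (- hy t) ^+ 2 +
      dot (- my t - - hy t) ((iterate t).2 - (ghost t).2)).
  apply: (@ghost_regret R n BY (step_y p) r B2 (fun t => (iterate t).2)
    (fun t => (ghost t).2) (fun t => - hy t) (fun t => - my t) y T) => //.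
  - by move: yr; rewrite /eball /= enormBC.
  - by move=> t; rewrite enormN; exact: mean_y.
  - by move=> t; rewrite scalerN opprK.
  - by move=> t; rewrite -opprD scalerN opprK.
(* The value of [f] at the current pair is inserted between the two terms, and each difference is
   bounded by a subgradient there. *)
have hsum : \sum_(t < T) (f (iterate t).1 y - f x (iterate t).2) <=
    \sum_(t < T) dot (mx t) ((iterate t).1 - x) +
    \sum_(t < T) dot (- my t) ((iterate t).2 - y).
  rewrite -big_split; apply: ler_sum => t _ /=.
  have [sx sy] := G_unbiased (Xt t) (Yt t).
  have := sx _ Xx; have := sy _ Yy; rewrite -/(mx t) -/(my t) => h1 h2.
  have e1 : dot (mx t) ((iterate t).1 - x) = - dot (mx t) (x - (iterate t).1).
    by rewrite -dotNr opprB.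
  have e2 : dot (- my t) ((iterate t).2 - y) = dot (my t) (y - (iterate t).2).
    by rewrite dotNl -dotNr opprB.
  by rewrite e1 e2; lra.
apply: (le_trans hsum); apply: (le_trans (lerD kx ky)).
have -> : \sum_(t < T) (3 * step_x p / 2 * enorm (hx t) ^+ 2 +
    3 * step_y p / 2 * enorm (hy t) ^+ 2 + noise_sum (iterate t) (ghost t) (s t)) =
    \sum_(t < T) (3 * step_x p / 2 * enorm (hx t) ^+ 2 +
      dot (mx t - hx t) ((iterate t).1 - (ghost t).1)) +
    \sum_(t < T) (3 * step_y p / 2 * enorm (- hy t) ^+ 2 +
      dot (- my t - - hy t) ((iterate t).2 - (ghost t).2)).
  rewrite -big_split; apply: eq_bigr => t _ /=.
  rewrite enormN -opprD dotNl -dotNr opprB /noise_sum /noise_x /noise_y.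
  rewrite -/(mx t) -/(my t) -/(hx t) -/(hy t); ring.
lra.
Qed.

End Epoch.

(** * From competitors in the balls to all competitors *)

Section LocalToGlobal.
Context {R : realType}.

(** A single subgradient at the intermediate point is used against both ends. With weights [1 - s]
    and [s] its linear terms cancel, and the quadratic ones add up through
    [(1 - s) s^2 + s (1 - s)^2 = s (1 - s)]. *)
Lemma strongly_convex_comb d (C : set 'rV[R]_d) (h : 'rV[R]_d -> R) (mu s : R)
    (a b v : 'rV[R]_d) : convex_set C -> strongly_convex mu C h -> C a -> C b ->
  0 <= s <= 1 -> subdiff C h ((1 - s) *: a + s *: b) v ->
  h ((1 - s) *: a + s *: b) + mu / 2 * (s * (1 - s)) * enorm (b - a) ^+ 2 <=
    (1 - s) * h a + s * h b.
Proof.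
move=> vC sc Ca Cb s01; have Cc := convex_comb vC Ca Cb s01.
set c := _ + _ in Cc * => hv; move: s01 => /andP[s0 s1].
have s1' : 0 <= 1 - s by rewrite subr_ge0.
have ha := ler_wpM2l s1' (sc _ _ _ Ca Cc hv).
have hb := ler_wpM2l s0 (sc _ _ _ Cb Cc hv).
have ea : a - c = - s *: (b - a) by apply/rowP => i; rewrite /c !mxE; ring.
have eb : b - c = (1 - s) *: (b - a) by apply/rowP => i; rewrite /c !mxE; ring.
move: ha hb; rewrite ea eb !enormZ !dotZr normrN (ger0_norm s0) (ger0_norm s1').
rewrite !exprMn; lra.
Qed.

Context {d n : nat} (X : set 'rV[R]_d) (Y : set 'rV[R]_n)
  (f : 'rV[R]_d -> 'rV[R]_n -> R) (mu lambda m r : R).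
Hypotheses (vX : convex_set X) (vY : convex_set Y).
Hypotheses (m_gt0 : 0 < m) (m_mu : m <= mu) (m_lambda : m <= lambda) (r_gt0 : 0 < r).
Hypotheses (f_sconvex : forall y, Y y -> strongly_convex mu X (f^~ y))
  (f_sconcave : forall x, X x -> strongly_concave lambda Y (f x)).
Hypotheses (subx : forall x y, X x -> Y y -> exists v, subdiff X (f^~ y) x v)
  (suby : forall x y, X x -> Y y -> exists v, superdiff Y (f x) y v).

(* A point outside the balls is pulled back along the segment to [(x0, y0)]
   until it reaches their boundary; strong convexity makes up for the initial
   gap lost on the way. *)
Lemma gap_le_of_local (x0 xb : 'rV[R]_d) (y0 yb : 'rV[R]_n) :
  X x0 -> Y y0 -> X xb -> Y yb ->
  (gap X Y f x0 y0 <= (m * r ^+ 2 / 8)%:E)%E ->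
  (forall x y, (X `&` eball x0 r) x -> (Y `&` eball y0 r) y ->
    f xb y - f x yb <= m * r ^+ 2 / 16) ->
  (gap X Y f xb yb <= (m * r ^+ 2 / 16)%:E)%E.
Proof.
move=> Xx0 Yy0 Xxb Yyb.
have X0 : X !=set0 by exists x0.
have Y0 : Y !=set0 by exists y0.
move=> /(gap_leP _ _ _ _ X0 Y0) g0 loc; apply/gap_leP => // x y Xx Yy.
set a := m * r ^+ 2 / 16 in loc *.
have a0 : 0 < a by rewrite /a !mulr_gt0 // exprn_gt0.
have g00 : f x0 yb - f xb y0 <= 2 * a.
  by apply: (le_trans (g0 _ _ Xxb Yyb)); rewrite /a; lra.
(* One fraction [s = r / N] is used for both players, so that their inequalities can be added; the
   farther one lands on its sphere, the other inside its ball. *)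
pose N := Num.max (enorm (x - x0)) (enorm (y - y0)).
have [Nr|rN] := leP N r.
  move: Nr; rewrite ge_max => /andP[xr yr].
  by apply: loc; split.
have N0 : 0 < N := lt_trans r_gt0 rN.
pose s := r / N.
have s0 : 0 < s by rewrite divr_gt0.
have s1 : s < 1 by rewrite ltr_pdivrMr // mul1r.
have s01 : 0 <= s <= 1 by rewrite !ltW.
have xN : enorm (x - x0) <= N by rewrite le_max lexx.
have yN : enorm (y - y0) <= N by rewrite le_max lexx orbT.
pose xs := (1 - s) *: x0 + s *: x; pose ys := (1 - s) *: y0 + s *: y.
have Xxs : X xs by exact: convex_comb.
have Yys : Y ys by exact: convex_comb.
have xsr : eball x0 r xs.
  rewrite /eball /= (_ : xs - x0 = s *: (x - x0)); last first.
    by apply/rowP => i; rewrite !mxE; ring.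
  rewrite enormZ gtr0_norm // (@le_trans _ _ (s * N)) ?ler_wpM2l ?(ltW s0) //.
  by rewrite /s divfK ?gt_eqF.
have ysr : eball y0 r ys.
  rewrite /eball /= (_ : ys - y0 = s *: (y - y0)); last first.
    by apply/rowP => i; rewrite !mxE; ring.
  rewrite enormZ gtr0_norm // (@le_trans _ _ (s * N)) ?ler_wpM2l ?(ltW s0) //.
  by rewrite /s divfK ?gt_eqF.
have L := loc _ _ (conj Xxs xsr) (conj Yys ysr).
have [v hv] := subx Xxs Yyb; have [w hw] := suby Xxb Yys.
have hx := strongly_convex_comb vX (f_sconvex Yyb) Xx0 Xx s01 hv.
have hw' : subdiff Y (fun y => - f xb y) ys (- w).
  by move=> z Yz; rewrite dotNl -opprD lerN2; exact: hw.
have hy := strongly_convex_comb vY (f_sconcave Xxb) Yy0 Yy s01 hw'.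
rewrite -/xs in hx; rewrite -/ys in hy.
have ss0 : 0 <= s * (1 - s) by rewrite mulr_ge0 ?(ltW s0) // subr_ge0 ltW.
have NN : m / 2 * (s * (1 - s)) * N ^+ 2 <=
    mu / 2 * (s * (1 - s)) * enorm (x - x0) ^+ 2 +
    lambda / 2 * (s * (1 - s)) * enorm (y - y0) ^+ 2.
  have mu0 : 0 < mu := lt_le_trans m_gt0 m_mu.
  have la0 : 0 < lambda := lt_le_trans m_gt0 m_lambda.
  have tx : m / 2 * (s * (1 - s)) * enorm (x - x0) ^+ 2 <=
      mu / 2 * (s * (1 - s)) * enorm (x - x0) ^+ 2.
    by rewrite ler_wpM2r ?sqr_ge0 // ler_wpM2r // ler_pM2r.
  have ty : m / 2 * (s * (1 - s)) * enorm (y - y0) ^+ 2 <=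
      lambda / 2 * (s * (1 - s)) * enorm (y - y0) ^+ 2.
    by rewrite ler_wpM2r ?sqr_ge0 // ler_wpM2r // ler_pM2r.
  have c0 : 0 <= m / 2 * (s * (1 - s)) by rewrite mulr_ge0 // divr_ge0 // ltW.
  have px := mulr_ge0 c0 (sqr_ge0 (enorm (x - x0))).
  have py := mulr_ge0 c0 (sqr_ge0 (enorm (y - y0))).
  have [->|->] : N = enorm (x - x0) \/ N = enorm (y - y0).
    by rewrite /N; case: leP; [right|left].
  - by move: tx ty px py; lra.
  - by move: tx ty px py; lra.
have mN : m / 2 * (s * (1 - s)) * N ^+ 2 = 8 * a * (1 - s) / s.
  by rewrite /a /s; field; rewrite !gt_eqF.
have D0 : (1 - s) * (f x0 yb - f xb y0) <= (1 - s) * (2 * a).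
  by rewrite ler_wpM2l // subr_ge0 ltW.
have : s * (f xb y - f x yb) <= a + (1 - s) * (2 * a) - 8 * a * (1 - s) / s.
  by move: hx hy NN D0 L; rewrite mN; lra.
(* The loss beyond [s * a] is [3 a (1 - s)], while strong convexity gains [8 a (1 - s) / s], which
   is larger since [s < 1]. *)
move=> h; rewrite -(ler_pM2l s0) (le_trans h) // -subr_ge0.
have -> : s * a - (a + (1 - s) * (2 * a) - 8 * a * (1 - s) / s) =
    a / s * ((1 - s) * (8 - 3 * s)) by field; rewrite gt_eqF.
apply: mulr_ge0; first by rewrite divr_ge0 ?(ltW a0) ?(ltW s0).
by apply: mulr_ge0; move: s1; lra.
Qed.

End LocalToGlobal.

Section Temperature.
Context {R : realType}.

(* [k] is the constant of [centered_exp_moment]; the two cases of the proof are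
   [L <= 5/21], where [th T = 2 L / A], and [L >= 5/21], where [th T = 1/12]. *)
Lemma exists_temperature (S U L A B1 B2 Q T : R) : 0 < U -> S ^+ 2 = 32 * U ->
  0 < L -> A = 5 + 3 * L ->
  0 < B1 -> 0 < B2 -> 0 < Q -> 1 <= T ->
  96 * U * L * (B1 + B2) ^+ 2 <= T * Q ^+ 2 ->
  U * A * B1 ^+ 2 <= T * Q ^+ 2 -> U * A * B2 ^+ 2 <= T * Q ^+ 2 ->
  exists th k : R, let s := S * th * A * (B1 + B2) / Q in
  [/\ 0 < th <= 12^-1, (s ^+ 2 <= 3^-1 /\ k = 3 / 2) \/ k = 4 &
    U * A ^+ 2 * (B1 ^+ 2 + B2 ^+ 2) / Q ^+ 2 + 10 * T +
      T * (k * s ^+ 2 / (2 * th)) + L / th <= 5 * A * T].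
Proof.
(* In the application [U = 3200], [S = 320] and [Q = m r]; the final inequality is the budget of one
   epoch after scaling the regret by [c]. *)
move=> U0 SU L0 AE b1 b2 Q0 T1 H1 H2 H3.
have A0 : 0 < A by lra.
have T0 : 0 < T by lra.
have Q2 : 0 < Q ^+ 2 by rewrite exprn_gt0.
pose w := (B1 + B2) ^+ 2 / Q ^+ 2.
have w0 : 0 <= w by rewrite divr_ge0 ?sqr_ge0 // ltW.
have Lw : 96 * U * L * w <= T by rewrite /w mulrA ler_pdivrMr.
pose e := (B1 ^+ 2 + B2 ^+ 2) / Q ^+ 2.
have e1 : U * A * e <= 2 * T.
  by rewrite /e mulrA ler_pdivrMr //; move: H2 H3; lra.
have e2 : e <= w.
  rewrite ler_pM2r ?invr_gt0 // -subr_ge0.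
  have -> : (B1 + B2) ^+ 2 - (B1 ^+ 2 + B2 ^+ 2) = 2 * (B1 * B2) by ring.
  by rewrite mulr_ge0 // mulr_ge0 // ltW.
have De : U * A ^+ 2 * (B1 ^+ 2 + B2 ^+ 2) / Q ^+ 2 = A * (U * A * e).
  by rewrite /e; field; rewrite gt_eqF.
have sE th : (S * th * A * (B1 + B2) / Q) ^+ 2 = 32 * U * th ^+ 2 * A ^+ 2 * w.
  by rewrite /w -SU; field; rewrite gt_eqF.
(* For [T >= 1] the choice [th = 2 L / (A T)] is at most [1/12] as soon as [24 L <= 5 + 3 L], that
   is [L <= 5/21]. *)
have [Ls|Ll] := leP L (5 / 21).
  pose th := 2 * L / (A * T).
  have th0 : 0 < th by rewrite divr_gt0 ?mulr_gt0.
  have thT : th * (A * T) = 2 * L by rewrite divfK // mulf_neq0 // gt_eqF.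
  exists th, (3 / 2) => s; rewrite {}/s sE; split.
  - rewrite th0 /= ler_pdivrMr ?mulr_gt0 //.
    have : A * 1 <= A * T by rewrite ler_pM2l.
    by move: Ls; rewrite AE; lra.
  - left; split => //.
    (* The square is at most [4 L / (3 T)], below [1/3] because [L <= 5/21 < 1/4]; the sharper
       constant [3/2] is thus available. *)
    have -> : 32 * U * th ^+ 2 * A ^+ 2 * w =
        (4 * L / (3 * T ^+ 2)) * (96 * U * L * w).
      by rewrite /th; field; rewrite !gt_eqF.
    apply: (@le_trans _ _ (4 * L / (3 * T ^+ 2) * T)).
      by rewrite ler_wpM2l // divr_ge0 ?mulr_ge0 ?sqr_ge0 // ltW.
    have -> : 4 * L / (3 * T ^+ 2) * T = 4 * L / 3 / T.
      by field; rewrite gt_eqF.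
    by rewrite ler_pdivrMr //; move: Ls T1; lra.
  (* The four terms are at most [2], [2], [1/2] and [1/2] times [A T], which exhausts the budget
     [5 A T]. *)
  - have -> : T * (3 / 2 * (32 * U * th ^+ 2 * A ^+ 2 * w) / (2 * th)) =
        A / 2 * (96 * U * L * w).
      by rewrite /th; field; rewrite !gt_eqF.
    have -> : L / th = A * T / 2 by rewrite /th; field; rewrite !gt_eqF.
    rewrite De.
    have := ler_wpM2l (ltW A0) e1.
    have := ler_wpM2l (ltW A0) Lw.
    have : 5 * T <= A * T by rewrite ler_pM2r // AE; move: L0; lra.
    lra.
pose th := 12^-1 / T.
have th0 : 0 < th by rewrite divr_gt0.
exists th, 4 => s; rewrite {}/s sE; split.
- by rewrite th0 /= ler_pdivrMr // ler_peMr.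
- by right.
- have -> : T * (4 * (32 * U * th ^+ 2 * A ^+ 2 * w) / (2 * th)) =
      A ^+ 2 / (18 * L) * (96 * U * L * w).
    by rewrite /th; field; rewrite !gt_eqF.
  have -> : L / th = 12 * L * T by rewrite /th; field; rewrite !gt_eqF.
  rewrite De.
  have h1 : A * (U * A * e) <= A ^+ 2 / (96 * L) * T.
    apply: (@le_trans _ _ (A ^+ 2 / (96 * L) * (96 * U * L * w))).
      rewrite (_ : A ^+ 2 / (96 * L) * (96 * U * L * w) = A * (U * A * w)); last first.
        by field; rewrite gt_eqF.
      by rewrite ler_pM2l // ler_pM2l // mulr_gt0.
    by rewrite ler_wpM2l // divr_ge0 ?sqr_ge0 // mulr_ge0 // ltW.
  have h2 : A ^+ 2 / (18 * L) * (96 * U * L * w) <= A ^+ 2 / (18 * L) * T.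
    by rewrite ler_wpM2l // divr_ge0 ?sqr_ge0 // mulr_ge0 // ltW.
  have h3 : A ^+ 2 / (96 * L) + A ^+ 2 / (18 * L) + 10 + 12 * L <= 5 * A.
    rewrite -subr_ge0 AE.
    have -> : 5 * (5 + 3 * L) - ((5 + 3 * L) ^+ 2 / (96 * L) +
        (5 + 3 * L) ^+ 2 / (18 * L) + 10 + 12 * L) =
        (288 * (15 * L + 3 * L ^+ 2) - 19 * (25 + 30 * L + 9 * L ^+ 2)) / (288 * L).
      by field; rewrite gt_eqF.
    rewrite divr_ge0 ?mulr_ge0 ?(ltW L0) //.
    by have := sqr_ge0 L; move: Ll; lra.
  have := ler_wpM2r (ltW T0) h3.
  by move: h1 h2; lra.
Qed.

End Temperature.

(** * The exponential supermartingale of one epoch *)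

Section RandomEpoch.
Context {R : realType} {d n : nat} {dXi : measure_display} {Xi : measurableType dXi}
  {dO : measure_display} {Omega : measurableType dO}.
Variables (X : set 'rV[R]_d) (Y : set 'rV[R]_n) (D : probability Xi R)
  (P : probability Omega R).
Variables (Gx : 'rV[R]_d -> 'rV[R]_n -> Xi -> 'rV[R]_d)
  (Gy : 'rV[R]_d -> 'rV[R]_n -> Xi -> 'rV[R]_n).
Hypotheses (cX : closed X) (vX : convex_set X) (cY : closed Y) (vY : convex_set Y).
Hypotheses (Gx_meas : measurable_oracle X Y Gx) (Gy_meas : measurable_oracle X Y Gy).
Variables (B1 B2 : R).
Hypotheses (B1_gt0 : 0 < B1) (B2_gt0 : 0 < B2)
  (Gx_exp : exp_moment_bound D X Y Gx B1) (Gy_exp : exp_moment_bound D X Y Gy B2).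
Variable xi : nat -> nat -> {RV P >-> Xi}.
Hypothesis xi_fresh : fresh_samples D xi.

Let Z (kt : nat * nat) := xi kt.1 kt.2.

(** Lexicographic order on samples. An earlier epoch contributes all its indices, so [past k t] lies
    in [past k.+1 0] whatever the epoch length. *)
Definition past (k t : nat) : set (nat * nat) :=
  [set kt | (kt.1 < k)%N \/ kt.1 = k /\ (kt.2 < t)%N].

Lemma pastW k t t' : (t <= t')%N -> past k t `<=` past k t'.
Proof.
by move=> tt' [i j] [?|[? jt]]; [left|right; split => //; exact: leq_trans jt tt'].
Qed.

Lemma pastS k t : past k t `<=` past k.+1 0.
Proof. by move=> [i j] [/= ik|[/= -> _]]; left; rewrite /= // ltnW. Qed.

Lemma past_sample k t : past k t.+1 (k, t).
Proof. by right; split => /=. Qed.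

Lemma past_fresh k t : ~ past k t (k, t).
Proof. by move=> [/=|[_ /=]]; rewrite ltnn. Qed.

Definition adapted k t {m : nat} (h : Omega -> 'rV[R]_m) :=
  coord_measurable (h : history Z (past k t) -> 'rV[R]_m).

Lemma adaptedW k t t' m (h : Omega -> 'rV[R]_m) : (t <= t')%N ->
  adapted k t h -> adapted k t' h.
Proof. by move=> tt' ah i; exact: (measurable_fun_historyW (pastW tt') (ah i)). Qed.

Lemma adaptedS k t m (h : Omega -> 'rV[R]_m) : adapted k t h -> adapted k.+1 0 h.
Proof. by move=> ah i; exact: (measurable_fun_historyW (@pastS k t) (ah i)). Qed.

Lemma adapted_coord_measurable k t m (h : Omega -> 'rV[R]_m) :
  adapted k t h -> coord_measurable h.
Proof.
move=> ah i _ B mB; rewrite setTI.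
have := ah i measurableT B mB; rewrite setTI.
exact: history_measurable.
Qed.

Variables (p : epoch_params R) (k : nat) (z0 : Omega -> 'rV[R]_d * 'rV[R]_n).
Let r := radius p.
Hypotheses (r_gt0 : 0 < r).
Hypotheses (Xz0 : forall w, X (z0 w).1) (Yz0 : forall w, Y (z0 w).2).
Hypotheses (z0x_adapted : adapted k 0 (fun w => (z0 w).1))
  (z0y_adapted : adapted k 0 (fun w => (z0 w).2)).

Let s w t := xi k t w.
Let iterate t w := inner_iterate X Y Gx Gy p (z0 w) (s w) t.
Let ghost t w := ghost_iterate X Y D Gx Gy p (z0 w) (s w) t.

Let Xit t w : X (iterate t w).1.
Proof. by have [[]] := inner_iterate_in Gx Gy cX cY r_gt0 (s w) (Xz0 w) (Yz0 w) t. Qed.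

Let Yit t w : Y (iterate t w).2.
Proof. by have [_ []] := inner_iterate_in Gx Gy cX cY r_gt0 (s w) (Xz0 w) (Yz0 w) t. Qed.

Section joint_measurability.
Context {dT : measure_display} {T : measurableType dT}.
Variables (z g : T -> 'rV[R]_d * 'rV[R]_n) (u : T -> Xi).
Hypotheses (mz1 : coord_measurable (fun t => (z t).1))
  (mz2 : coord_measurable (fun t => (z t).2))
  (mg1 : coord_measurable (fun t => (g t).1))
  (mg2 : coord_measurable (fun t => (g t).2))
  (mu : measurable_fun setT u).
Hypotheses (Xz : forall t, X (z t).1) (Yz : forall t, Y (z t).2).

Lemma coord_measurable_Gx : coord_measurable (fun t => Gx (z t).1 (z t).2 (u t)).
Proof. exact: (coord_measurable_oracle cX cY Gx_meas mz1 mz2 mu Xz Yz). Qed.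

Lemma coord_measurable_Gy : coord_measurable (fun t => Gy (z t).1 (z t).2 (u t)).
Proof. exact: (coord_measurable_oracle cX cY Gy_meas mz1 mz2 mu Xz Yz). Qed.

Lemma coord_measurable_noise_x : coord_measurable (fun t => noise_x D Gx (z t) (u t)).
Proof.
apply: coord_measurableB; last exact: coord_measurable_Gx.
exact: (coord_measurable_mean_vector cX cY Gx_meas D mz1 mz2 Xz Yz).
Qed.

Lemma coord_measurable_noise_y : coord_measurable (fun t => noise_y D Gy (z t) (u t)).
Proof.
apply: coord_measurableB; last exact: coord_measurable_Gy.
exact: (coord_measurable_mean_vector cX cY Gy_meas D mz1 mz2 Xz Yz).
Qed.

Lemma measurable_noise_sum :
  measurable_fun setT (fun t => noise_sum D Gx Gy (z t) (g t) (u t)).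
Proof.
apply: measurable_funD; apply: measurable_dot.
- exact: coord_measurable_noise_x.
- exact: (coord_measurableB mz1 mg1).
- exact: coord_measurable_noise_y.
- exact: (coord_measurableB mg2 mz2).
Qed.

End joint_measurability.

Lemma iterate_adapted t :
  (adapted k t (fun w => (iterate t w).1) /\ adapted k t (fun w => (iterate t w).2)) /\
  (adapted k t (fun w => (ghost t w).1) /\ adapted k t (fun w => (ghost t w).2)).
Proof.
elim: t => [|t [[i1 i2] [g1 g2]]]; first by split; split.
have tS := leqnSn t.
have {}i1 := adaptedW tS i1; have {}i2 := adaptedW tS i2.
have {}g1 := adaptedW tS g1; have {}g2 := adaptedW tS g2.
have z1 := adaptedW (leq0n t.+1) z0x_adapted.
have z2 := adaptedW (leq0n t.+1) z0y_adapted.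
have mu : measurable_fun setT (fun w : history Z (past k t.+1) => s w t).
  exact (@measurable_sample R dO dXi Omega Xi _ P Z (past k t.+1) (k, t) (past_sample k t)).
pose H := history Z (past k t.+1).
have X0 : forall w : H, X (z0 w).1 := Xz0.
have Y0 : forall w : H, Y (z0 w).2 := Yz0.
have X1 : forall w : H, X (iterate t w).1 := Xit t.
have Y1 : forall w : H, Y (iterate t w).2 := Yit t.
split; split.
- apply: (measurable_proj_ball cX vX r_gt0 X0 z1).
  apply: (coord_measurableB i1 _); apply: coord_measurableZ.
  exact: (coord_measurable_Gx i1 i2 mu X1 Y1).
- apply: (measurable_proj_ball cY vY r_gt0 Y0 z2).
  apply: (coord_measurableD i2 _); apply: coord_measurableZ.
  exact: (coord_measurable_Gy i1 i2 mu X1 Y1).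
- apply: (measurable_proj_ball cX vX r_gt0 X0 z1).
  apply: (coord_measurableB g1 _); apply: coord_measurableZ.
  exact: (coord_measurable_noise_x i1 i2 mu X1 Y1).
- apply: (measurable_proj_ball cY vY r_gt0 Y0 z2).
  apply: (coord_measurableD g2 _); apply: coord_measurableZ.
  exact: (coord_measurable_noise_y i1 i2 mu X1 Y1).
Qed.

Lemma epoch_average_adapted :
  adapted k.+1 0 (fun w => (epoch_average X Y Gx Gy p (z0 w) (s w)).1) /\
  adapted k.+1 0 (fun w => (epoch_average X Y Gx Gy p (z0 w) (s w)).2).
Proof.
split; apply: (@adaptedS k (nb_iter p)); apply: coord_measurableZ;
  apply: coord_measurable_sum => t.
- by apply: (@adaptedW k t) => //; [exact: ltnW|have [[]] := iterate_adapted t].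
- by apply: (@adaptedW k t) => //; [exact: ltnW|have [[]] := iterate_adapted t].
Qed.

Variables (th c kap : R).
(** The parameter [s] of [step_exp_moment] with radius [2 * r]: iterate and ghost lie in one ball of
    radius [r]. *)
Let sg := 2 * th * c * (2 * r) * (B1 + B2).
Hypotheses (th01 : 0 <= th <= 12^-1) (c_ge0 : 0 <= c)
  (sgP : (sg ^+ 2 <= 3^-1 /\ kap = 3 / 2) \/ kap = 4).

(** The bracket is [c] times the random part of the regret at one step, once the step sizes are
    inserted; the subtracted constant compensates its exponential moment. *)
Definition increment (z g : 'rV[R]_d * 'rV[R]_n) (u : Xi) : R :=
  th * (3 * (enorm (Gx z.1 z.2 u) ^+ 2 / B1 ^+ 2) +
        3 * (enorm (Gy z.1 z.2 u) ^+ 2 / B2 ^+ 2) + c * noise_sum D Gx Gy z g u)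
  - (6 * th + kap * sg ^+ 2 / 2).

Lemma measurable_increment {dT : measure_display} {T : measurableType dT}
  (z g : T -> 'rV[R]_d * 'rV[R]_n) (u : T -> Xi) :
  coord_measurable (fun t => (z t).1) -> coord_measurable (fun t => (z t).2) ->
  coord_measurable (fun t => (g t).1) -> coord_measurable (fun t => (g t).2) ->
  measurable_fun setT u -> (forall t, X (z t).1) -> (forall t, Y (z t).2) ->
  measurable_fun setT (fun t => increment (z t) (g t) (u t)).
Proof.
move=> z1 z2 g1 g2 mu Xz Yz; apply: measurable_funB => //.
apply: measurable_funM => //; apply: measurable_funD.
  apply: measurable_funD; apply: measurable_funM => //;
    apply: measurable_funM => //; apply: measurable_funX; apply: measurable_enorm.
  - exact: (coord_measurable_Gx z1 z2 mu Xz Yz).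
  - exact: (coord_measurable_Gy z1 z2 mu Xz Yz).
apply: measurable_funM => //.
exact: (measurable_noise_sum z1 z2 g1 g2 mu Xz Yz).
Qed.

Lemma section_coord_measurable x y : X x -> Y y ->
  coord_measurable (Gx x y) /\ coord_measurable (Gy x y).
Proof.
move=> Xx Yy; split.
- exact: (coord_measurable_oracle cX cY Gx_meas (coord_measurable_cst x)
    (coord_measurable_cst y) (@measurable_id _ Xi setT)).
- exact: (coord_measurable_oracle cX cY Gy_meas (coord_measurable_cst x)
    (coord_measurable_cst y) (@measurable_id _ Xi setT)).
Qed.

Lemma mean_vector_bounds x y : X x -> Y y ->
  enorm (mean_vector D (Gx x y)) <= B1 /\ enorm (mean_vector D (Gy x y)) <= B2.
Proof.
move=> Xx Yy; have [mx my] := section_coord_measurable Xx Yy; split.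
- exact: (enorm_mean_vector mx B1_gt0 (Gx_exp Xx Yy)).
- exact: (enorm_mean_vector my B2_gt0 (Gy_exp Xx Yy)).
Qed.

Lemma increment_exp_moment z g : X z.1 -> Y z.2 ->
  enorm (z.1 - g.1) <= 2 * r -> enorm (g.2 - z.2) <= 2 * r ->
  (\int[D]_u (expR (increment z g u))%:E <= 1)%E.
Proof.
move=> Xz Yz zg1 zg2; have [mx my] := section_coord_measurable Xz Yz.
have r2 : 0 < 2 * r by rewrite mulr_gt0.
exact: (step_exp_moment mx my B1_gt0 B2_gt0 (Gx_exp Xz Yz) (Gy_exp Xz Yz)
  r2 zg1 zg2 th01 c_ge0 sgP).
Qed.

Lemma measurable_partial_sum t :
  measurable_fun setT (fun w : history Z (past k t) =>
    \sum_(j < t) increment (iterate j w) (ghost j w) (s w j)).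
Proof.
elim: t => [|t IH]; first by under eq_fun do rewrite big_ord0; exact: measurable_cst.
under eq_fun do rewrite big_ord_recr /=.
apply: measurable_funD; first exact: (measurable_fun_historyW (pastW (leqnSn t)) IH).
have [[i1 i2] [g1 g2]] := iterate_adapted t.
have tS := leqnSn t.
pose H := history Z (past k t.+1).
have X1 : forall w : H, X (iterate t w).1 := Xit t.
have Y1 : forall w : H, Y (iterate t w).2 := Yit t.
have mu := @measurable_sample R dO dXi Omega Xi _ P Z (past k t.+1) (k, t) (past_sample k t).
exact: (@measurable_increment _ H (iterate t) (ghost t) (fun w => s w t)
  (adaptedW tS i1) (adaptedW tS i2) (adaptedW tS g1) (adaptedW tS g2) mu X1 Y1).
Qed.

(** The partial sum, the iterate and the ghost at time [t] depend only on [past k t], so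
    [fresh_integral] replaces sample [(k, t)] by an inner integral over [D], where
    [increment_exp_moment] bounds the new factor by 1. *)
Lemma exp_supermartingale t :
  (\int[P]_w (expR (\sum_(j < t) increment (iterate j w) (ghost j w) (s w j)))%:E <= 1)%E.
Proof.
elim: t => [|t IH].
  under eq_integral do rewrite big_ord0 expR0.
  by rewrite integral_cst // mul1e; exact: probability_le1.
pose S w := \sum_(j < t) increment (iterate j w) (ghost j w) (s w j).
pose phi (wu : history Z (past k t) * Xi) : \bar R :=
  (expR (S wu.1 + increment (iterate t wu.1) (ghost t wu.1) wu.2))%:E.
have mS : measurable_fun setT (S : history Z (past k t) -> R).
  exact: measurable_partial_sum.
have [[i1 i2] [g1 g2]] := iterate_adapted t.
have mphi : measurable_fun setT phi.
  apply/measurable_EFinP/measurableT_comp => //; apply: measurable_funD.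
    exact: (measurableT_comp mS measurable_fst).
  apply: (@measurable_increment _ (history Z (past k t) * Xi)%type
    (fun wu => iterate t wu.1) (fun wu => ghost t wu.1) snd) => //.
  - by move=> i; exact: (measurableT_comp (i1 i) measurable_fst).
  - by move=> i; exact: (measurableT_comp (i2 i) measurable_fst).
  - by move=> i; exact: (measurableT_comp (g1 i) measurable_fst).
  - by move=> i; exact: (measurableT_comp (g2 i) measurable_fst).
have phi0 wu : (0 <= phi wu)%E by rewrite lee_fin expR_ge0.
have law kt (A : set Xi) : measurable A -> P (Z kt @^-1` A) = D A.
  by case: kt => i j; exact: xi_fresh.1.
have := fresh_integral law xi_fresh.2 (past_fresh (k := k) (t := t)) mphi phi0.
rewrite /phi /= => E.
under eq_integral do rewrite big_ord_recr /=.
rewrite E; apply: le_trans IH; apply: ge0_le_integral => //.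
- by move=> w _; apply: integral_ge0 => u _; rewrite lee_fin expR_ge0.
- move=> _ B mB; have mF := measurable_fun_fubini_tonelli_F (m2 := D) phi mphi phi0.
  by have := mF measurableT B mB; rewrite !setTI; exact: history_measurable.
- apply/measurable_EFinP/measurableT_comp => //.
  by move=> _ B mB; have := mS measurableT B mB; rewrite !setTI; exact: history_measurable.
move=> w _; under eq_integral do rewrite expRD EFinM.
have [d1 d2] := iterate_ghost_dist D Gx Gy cX cY r_gt0 (s w) (Xz0 w) (Yz0 w) t.
have h := increment_exp_moment (Xit t w) (Yit t w) d1 d2.
rewrite ge0_integralZl_EFin ?expR_ge0 //.
  by rewrite -[leRHS]mule1 lee_pmul2l // lte_fin expR_gt0.
apply/measurable_EFinP/measurableT_comp => //.
apply: (measurable_increment (z := fun=> iterate t w) (g := fun=> ghost t w)) => //;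
  exact: coord_measurable_cst.
Qed.

Lemma partial_sum_tail t (L : R) :
  measurable [set w | L <= \sum_(j < t) increment (iterate j w) (ghost j w) (s w j)] /\
  (P [set w | (L <= \sum_(j < t) increment (iterate j w) (ghost j w) (s w j))%R] <=
    (expR (- L))%:E)%E.
Proof.
pose S w := \sum_(j < t) increment (iterate j w) (ghost j w) (s w j).
have mS : measurable_fun setT S.
  move=> _ B mB; have := measurable_partial_sum (t := t) measurableT mB.
  by rewrite !setTI; exact: history_measurable.
set A := [set w | _ <= _].
have mA : measurable A.
  have := mS measurableT _ (measurable_itv `[L, +oo[).
  by rewrite setTI; congr measurable; apply/seteqP; split => w; rewrite /A /= in_itv /= andbT.
split => //.
have mE : measurable_fun setT (fun w => (expR (S w))%:E).
  by apply/measurable_EFinP/measurableT_comp.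
have := exp_supermartingale t; rewrite -/S => h.
have : ((expR L)%:E * P A <= 1)%E.
  apply: le_trans h; rewrite -integral_cst //.
  apply: (@le_trans _ _ (\int[P]_(w in A) (expR (S w))%:E)%E).
    apply: ge0_le_integral => //.
    - by move=> w _ /=; rewrite lee_fin expR_ge0.
    - exact: (measurable_funTS mE).
    - by move=> w; rewrite /A /= lee_fin ler_expR.
  exact: ge0_subset_integral.
have PA : P A \is a fin_num by exact: fin_num_measure.
rewrite -(fineK PA) -EFinM !lee_fin expRN mulrC -ler_pdivlMr ?expR_gt0 //.
by rewrite mul1r.
Qed.

End RandomEpoch.

(** * Chaining the epochs *)

Section EpochSuccess.
Context {R : realType} {d n : nat} {dXi : measure_display} {Xi : measurableType dXi}.
Variables (X : set 'rV[R]_d) (Y : set 'rV[R]_n) (f : 'rV[R]_d -> 'rV[R]_n -> R).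
Variables (D : probability Xi R).
Variables (Gx : 'rV[R]_d -> 'rV[R]_n -> Xi -> 'rV[R]_d)
  (Gy : 'rV[R]_d -> 'rV[R]_n -> Xi -> 'rV[R]_n).
Hypotheses (cX : closed X) (vX : convex_set X) (cY : closed Y) (vY : convex_set Y).
Variables (mu lambda m : R).
Hypotheses (m_gt0 : 0 < m) (m_mu : m <= mu) (m_lambda : m <= lambda).
Hypotheses (f_sconvex : forall y, Y y -> strongly_convex mu X (f^~ y))
  (f_sconcave : forall x, X x -> strongly_concave lambda Y (f x)).
Hypothesis G_unbiased : unbiased_oracle D X Y f Gx Gy.
Variables (B1 B2 : R).
Hypotheses (B1_gt0 : 0 < B1) (B2_gt0 : 0 < B2).
Hypotheses (mean_x : forall x y, X x -> Y y -> enorm (mean_vector D (Gx x y)) <= B1)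
  (mean_y : forall x y, X x -> Y y -> enorm (mean_vector D (Gy x y)) <= B2).
Variables (p : epoch_params R) (z0 : 'rV[R]_d * 'rV[R]_n) (s : nat -> Xi).
Let r := radius p.
Let T : R := (nb_iter p)%:R.
Hypotheses (r_gt0 : 0 < r) (T_gt0 : (0 < nb_iter p)%N) (Xz0 : X z0.1) (Yz0 : Y z0.2).
Variables (A L th kap : R).
Hypotheses (A_gt0 : 0 < A) (th_gt0 : 0 < th).
Hypotheses (step_xE : step_x p = m * r ^+ 2 / (40 * A * B1 ^+ 2))
  (step_yE : step_y p = m * r ^+ 2 / (40 * A * B2 ^+ 2)).
Let c := 80 * A / (m * r ^+ 2).
Let sg := 2 * th * c * (2 * r) * (B1 + B2).
Hypothesis budget : 3200 * A ^+ 2 * (B1 ^+ 2 + B2 ^+ 2) / (m * r) ^+ 2 + 10 * T +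
  T * (kap * sg ^+ 2 / (2 * th)) + L / th <= 5 * A * T.
Hypothesis small_sum : \sum_(t < nb_iter p) increment D Gx Gy B1 B2 p th c kap
  (inner_iterate X Y Gx Gy p z0 s t) (ghost_iterate X Y D Gx Gy p z0 s t) (s t) < L.

(** A pathwise statement. In [budget], the first term is the scaled initial distance, [10 * T]
    collects [4 * T] from the means and [6 * T] from the compensated squares, the third term is the
    noise compensator and [L / th] the Markov level. The factor 80 in [c] makes
    [c * (m * r ^+ 2 / 16)] equal to [5 * A]. *)
Lemma epoch_gap_le :
  (gap X Y f z0.1 z0.2 <= (m * r ^+ 2 / 8)%:E)%E ->
  (gap X Y f (epoch_average X Y Gx Gy p z0 s).1 (epoch_average X Y Gx Gy p z0 s).2
    <= (m * r ^+ 2 / 16)%:E)%E.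
Proof.
move=> g0; have [Xa Ya] := epoch_average_in Gx Gy cX vX cY vY r_gt0 s Xz0 Yz0 T_gt0.
apply: (gap_le_of_local vX vY m_gt0 m_mu m_lambda r_gt0 f_sconvex f_sconcave _ _
  Xz0 Yz0 Xa Ya g0).
- by move=> x y Xx Yy; exists (mean_vector D (Gx x y)); have [] := G_unbiased Xx Yy.
- by move=> x y Xx Yy; exists (mean_vector D (Gy x y)); have [] := G_unbiased Xx Yy.
move=> x y Bx By.
have mr : 0 < m * r ^+ 2 by rewrite mulr_gt0 // exprn_gt0.
have c_gt0 : 0 < c by rewrite /c divr_gt0 // mulr_gt0.
have ex0 : 0 < step_x p by rewrite step_xE divr_gt0 // !mulr_gt0 // exprn_gt0.
have ey0 : 0 < step_y p by rewrite step_yE divr_gt0 // !mulr_gt0 // exprn_gt0.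
have := epoch_regret cX vX cY vY r_gt0 ex0 ey0 s Xz0 Yz0 T_gt0 G_unbiased
  (ltW B1_gt0) (ltW B2_gt0) mean_x mean_y Bx By.
set F := f _ y - f x _; rewrite -/T.
set S := \sum_(t < _) _ => reg.
have cS : th * (c * S) - T * (6 * th + kap * sg ^+ 2 / 2) < L.
  apply: le_lt_trans small_sum; rewrite le_eqVlt; apply/orP; left; apply/eqP.
  rewrite /increment -/r -/sg sumrB; congr (_ - _); last first.
    by rewrite sumr_const card_ord -[RHS]mulr_natl.
  rewrite /S !mulr_sumr; apply: eq_bigr => t _; congr (th * _).
  set g1 := enorm _ ^+ 2; set g2 := enorm _ ^+ 2; set N := noise_sum _ _ _ _ _ _.
  by rewrite /c step_xE step_yE; field; rewrite !gt_eqF.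
have cS' : c * S <= L / th + 6 * T + T * (kap * sg ^+ 2 / (2 * th)).
  have -> : L / th + 6 * T + T * (kap * sg ^+ 2 / (2 * th)) =
      (L + T * (6 * th + kap * sg ^+ 2 / 2)) / th by field; rewrite gt_eqF.
  by rewrite ler_pdivlMr // mulrC; move: cS; lra.
have E1 : c * (r ^+ 2 / step_x p + r ^+ 2 / step_y p) =
    3200 * A ^+ 2 * (B1 ^+ 2 + B2 ^+ 2) / (m * r) ^+ 2.
  rewrite (_ : 3200 = 40 * 80); last by rewrite -natrM.
  by rewrite /c step_xE step_yE; field; rewrite !gt_eqF.
have E2 : c * (T * (step_x p * B1 ^+ 2 + step_y p * B2 ^+ 2)) = 4 * T.
  by rewrite /c step_xE step_yE; field; rewrite !gt_eqF.
have h := ler_wpM2l (ltW c_gt0) reg.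
have {h}h : c * (T * F) <= 5 * A * T.
  by move: h cS' budget; rewrite !(mulrDr c) E2 -mulrDr E1; lra.
have T0 : 0 < T by rewrite ltr0n.
have -> : m * r ^+ 2 / 16 = 5 * A / c by rewrite /c; field; rewrite !gt_eqF.
rewrite ler_pdivlMr // -(ler_pM2r T0); move: h; lra.
Qed.

End EpochSuccess.

(** * Parameters along the epochs *)

Section Schedule.
Context {R : realType}.
Variable p1 : epoch_params R.
Notation params k := (iter k (@next_params R) p1).

Lemma nb_iter_params k : nb_iter (params k) = (2 ^ k * nb_iter p1)%N.
Proof. by elim: k => [|k IH] /=; rewrite ?mul1n // IH mulnA -expnS. Qed.

Lemma radius_params k : radius (params k) ^+ 2 = radius p1 ^+ 2 / 2 ^+ k.
Proof.
elim: k => [|k IH]; first by rewrite expr0 divr1.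
by rewrite iterS /= exprMn IH exprVn sqr_sqrtr // -mulrA -invfM -exprSr.
Qed.

Lemma radius_params_gt0 k : 0 < radius p1 -> 0 < radius (params k).
Proof. by move=> r0; elim: k => [|k IH] //=; rewrite divr_gt0 // sqrtr_gt0. Qed.

Lemma step_x_params a k : step_x p1 = radius p1 ^+ 2 * a ->
  step_x (params k) = radius (params k) ^+ 2 * a.
Proof.
move=> h; rewrite radius_params; elim: k => [|k IH]; first by rewrite expr0 divr1.
rewrite iterS /= IH (exprSr (2 : R) k); field.
by rewrite expf_neq0.
Qed.

Lemma step_y_params a k : step_y p1 = radius p1 ^+ 2 * a ->
  step_y (params k) = radius (params k) ^+ 2 * a.
Proof.
move=> h; rewrite radius_params; elim: k => [|k IH]; first by rewrite expr0 divr1.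
rewrite iterS /= IH (exprSr (2 : R) k); field.
by rewrite expf_neq0.
Qed.

Lemma total_iterationsE K :
  (total_iterations p1 K)%:R = (nb_iter p1)%:R * (2 ^+ K - 1) :> R.
Proof.
rewrite /total_iterations natr_sum; under eq_bigr do rewrite nb_iter_params natrM natrX.
elim: K => [|K IH]; first by rewrite big_ord0 expr0 subrr mulr0.
by rewrite big_ord_recr /= IH exprS; ring.
Qed.

(** The lower bound on [2 ^+ K] gives the final accuracy, the upper one the iteration count. *)
Lemma ceil_log2_bounds (x : R) (K : nat) : 0 < x ->
  K%:Z = Num.ceil (ln x / ln 2) -> x <= 2 ^+ K < 2 * x.
Proof.
move=> x0 KE.
have l2 : 0 < ln 2 :> R by rewrite ln_gt0 // ltr1n.
have /andP[h1 h2] := ceil_itv (ln x / ln 2).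
rewrite -KE in h1 h2; rewrite rmorphB /= in h1.
have K2 : 0 < (2 : R) ^+ K by rewrite exprn_gt0.
have lnK : ln ((2 : R) ^+ K) = K%:R * ln 2 by rewrite lnXn // mulr_natl.
apply/andP; split.
  rewrite -ler_ln ?posrE // lnK -ler_pdivrMr //.
rewrite -ltr_ln ?posrE ?mulr_gt0 // lnM ?posrE // lnK.
by move: h1; rewrite ltr_pdivlMr // mulrBl mul1r; lra.
Qed.

End Schedule.

Section Epochs.
Context {R : realType} {d n : nat} {dXi : measure_display} {Xi : measurableType dXi}
  {dO : measure_display} {Omega : measurableType dO}.
Variables (X : set 'rV[R]_d) (Y : set 'rV[R]_n) (f : 'rV[R]_d -> 'rV[R]_n -> R).
Variables (D : probability Xi R) (P : probability Omega R).
Variables (Gx : 'rV[R]_d -> 'rV[R]_n -> Xi -> 'rV[R]_d)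
  (Gy : 'rV[R]_d -> 'rV[R]_n -> Xi -> 'rV[R]_n).
Hypotheses (cX : closed X) (vX : convex_set X) (cY : closed Y) (vY : convex_set Y).
Hypothesis f_cont : {within X `*` Y, continuous (fun z => f z.1 z.2)}.
Variables (mu lambda m : R).
Hypotheses (m_gt0 : 0 < m) (m_mu : m <= mu) (m_lambda : m <= lambda).
Hypotheses (f_sconvex : forall y, Y y -> strongly_convex mu X (f^~ y))
  (f_sconcave : forall x, X x -> strongly_concave lambda Y (f x)).
Hypotheses (Gx_meas : measurable_oracle X Y Gx) (Gy_meas : measurable_oracle X Y Gy).
Hypothesis G_unbiased : unbiased_oracle D X Y f Gx Gy.
Variables (B1 B2 : R).
Hypotheses (B1_gt0 : 0 < B1) (B2_gt0 : 0 < B2).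
Hypotheses (Gx_exp : exp_moment_bound D X Y Gx B1) (Gy_exp : exp_moment_bound D X Y Gy B2).
Variable xi : nat -> nat -> {RV P >-> Xi}.
Hypothesis xi_fresh : fresh_samples D xi.
Variables (x0 : 'rV[R]_d) (y0 : 'rV[R]_n).
Hypotheses (X_x0 : X x0) (Y_y0 : Y y0).
Variables (dt R1 : R) (T1 : nat).
Hypotheses (dt01 : 0 < dt < 1) (R1_gt0 : 0 < R1).
Let A := 5 + 3 * ln (1 / dt).
Hypothesis T1_ge : iteration_constant B1 B2 dt / (m ^+ 2 * R1 ^+ 2) <= T1%:R.
Let p1 := EpochParams (m * R1 ^+ 2 / (40 * A * B1 ^+ 2))
  (m * R1 ^+ 2 / (40 * A * B2 ^+ 2)) R1 T1.
Hypothesis gap0 : (gap X Y f x0 y0 <= (m * R1 ^+ 2 / 8)%:E)%E.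

Let params k := iter k (@next_params R) p1.
Let z k w := epoch_gda X Y Gx Gy p1 (x0, y0) (fun k t => xi k t w) k.
Let L := ln (1 / dt).

Let L_gt0 : 0 < L.
Proof.
by move: dt01 => /andP[d0 d1]; rewrite ln_gt0 // div1r invf_gt1.
Qed.

Let A_gt0 : 0 < A.
Proof. by rewrite /A -/L; move: L_gt0; lra. Qed.

Let T1m_ge : [/\ 96 * 3200 * L * (B1 + B2) ^+ 2 <= T1%:R * (m * R1) ^+ 2,
  3200 * A * B1 ^+ 2 <= T1%:R * (m * R1) ^+ 2 &
  3200 * A * B2 ^+ 2 <= T1%:R * (m * R1) ^+ 2].
Proof.
have mR : 0 < m ^+ 2 * R1 ^+ 2 by rewrite mulr_gt0 // exprn_gt0.
move: T1_ge; rewrite ler_pdivrMr // -exprMn /iteration_constant -/L -/A ge_max.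
have U0 : 0 <= 3200 * A by rewrite mulr_ge0 ?ler0n ?(ltW A_gt0).
rewrite (maxr_pMr _ _ U0) ge_max => /andP[h /andP[h1 h2]].
split; [apply: le_trans h|exact: h1|exact: h2].
 rewrite le_eqVlt; apply/orP; left; apply/eqP.
have -> : (3200 : R) = 32 * 100 by rewrite -natrM.
have -> : (320 : R) = 32 * 10 by rewrite -natrM.
by ring.
Qed.

Let T1_gt0 : (0 < T1)%N.
Proof.
have [_ h _] := T1m_ge; rewrite lt0n; apply/eqP => T0.
move: h; rewrite T0 mul0r leNgt => /negP; apply.
have U0 : 0 < (3200 : R) by rewrite ltr0n.
exact: (mulr_gt0 (mulr_gt0 U0 A_gt0) (exprn_gt0 2 B1_gt0)).
Qed.

Let nb_gt0 k : (0 < nb_iter (params k))%N.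
Proof. by rewrite nb_iter_params muln_gt0 expn_gt0. Qed.

Let rad_gt0 k : 0 < radius (params k).
Proof. exact: radius_params_gt0. Qed.

Lemma epoch_gda_in k w : X (z k w).1 /\ Y (z k w).2.
Proof.
elim: k => [|k [Xz Yz]] //.
exact: (epoch_average_in Gx Gy cX vX cY vY (rad_gt0 k) _ Xz Yz (nb_gt0 k)).
Qed.

Lemma epoch_gda_adapted k :
  adapted xi k 0 (fun w => (z k w).1) /\ adapted xi k 0 (fun w => (z k w).2).
Proof.
elim: k => [|k [ax ay]]; first by split; exact: coord_measurable_cst.
exact: (epoch_average_adapted D cX vX cY vY Gx_meas Gy_meas (rad_gt0 k)
  (fun w => (epoch_gda_in k w).1) (fun w => (epoch_gda_in k w).2) ax ay).
Qed.

Lemma measurable_epoch_gap k (a : R) :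
  measurable [set w | (gap X Y f (z k w).1 (z k w).2 <= a%:E)%E].
Proof.
have [ax ay] := epoch_gda_adapted k.
apply: (measurable_gap_le cX cY f_cont) => //.
- exact: adapted_coord_measurable ax.
- exact: adapted_coord_measurable ay.
- by move=> w; have [] := epoch_gda_in k w.
- by move=> w; have [] := epoch_gda_in k w.
- by exists x0.
- by exists y0.
Qed.

Let good k := [set w | (gap X Y f (z k w).1 (z k w).2
  <= (m * radius (params k) ^+ 2 / 8)%:E)%E].

(** An inclusion rather than a conditional probability: off [F] success propagates pathwise, so
    failures are only added. [F] is the event that the compensated sum reaches [L], and
    [expR (- L) = dt]. *)
Lemma epoch_failure k : exists2 F : set Omega, measurable F /\ (P F <= dt%:E)%E &
  ~` good k.+1 `<=` ~` good k `|` F.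
Proof.
set p := params k; set r := radius p; pose T : R := (nb_iter p)%:R.
have r0 : 0 < r by exact: rad_gt0.
have Q0 : 0 < m * r by rewrite mulr_gt0.
have T_ge1 : 1 <= T by rewrite ler1n; exact: nb_gt0.
(* Doubling the length offsets halving the squared radius, so the first-epoch conditions carry over
   unchanged. *)
have TQ : T * (m * r) ^+ 2 = T1%:R * (m * R1) ^+ 2.
  rewrite /T /p nb_iter_params natrM natrX !exprMn radius_params /=.
  by field; rewrite expf_neq0.
have [h1 h2 h3] := T1m_ge; rewrite -TQ in h1 h2 h3.
have SU : (320 : R) ^+ 2 = 32 * 3200.
  have -> : (3200 : R) = 32 * 100 by rewrite -natrM.
  have -> : (320 : R) = 32 * 10 by rewrite -natrM.
  by ring.
have U0 : 0 < (3200 : R) by rewrite ltr0n.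
have [th [kap]] := exists_temperature U0 SU L_gt0 erefl B1_gt0 B2_gt0 Q0 T_ge1 h1 h2 h3.
rewrite -/A -/L; set c := 80 * A / (m * r ^+ 2).
have -> : 320 * th * A * (B1 + B2) / (m * r) = 2 * th * c * (2 * r) * (B1 + B2).
  rewrite (_ : 320 = 4 * 80); last by rewrite -natrM.
  by rewrite /c; field; rewrite !gt_eqF.
move=> [/andP[th0 th1] sgP budget].
have th01 : 0 <= th <= 12^-1 by rewrite (ltW th0).
have c0 : 0 <= c by rewrite /c divr_ge0 // ?mulr_ge0 ?sqr_ge0 // ltW.
have [ax ay] := epoch_gda_adapted k.
have Xz w := (epoch_gda_in k w).1; have Yz w := (epoch_gda_in k w).2.
have [mF PF] := partial_sum_tail cX vX cY vY Gx_meas Gy_meas B1_gt0 B2_gt0 Gx_exp Gy_exp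
  xi_fresh r0 Xz Yz ax ay th01 c0 sgP (nb_iter p) L.
set F := [set w | _ <= _] in mF PF; exists F.
  split => //; apply: (le_trans PF).
  by rewrite lee_fin -lnV ?posrE ?div1r ?invrK ?lnK ?posrE ?invr_gt0;
    move: dt01 => /andP[].
move=> w bad; have [gk|] := pselect (good k w); last by left.
right; apply: contrapT => /negP; rewrite -ltNge => small; apply: bad.
have mean_x x y : X x -> Y y -> enorm (mean_vector D (Gx x y)) <= B1.
  by move=> Xx Yy; have [] := mean_vector_bounds cX cY Gx_meas Gy_meas B1_gt0 B2_gt0
    Gx_exp Gy_exp Xx Yy.
have mean_y x y : X x -> Y y -> enorm (mean_vector D (Gy x y)) <= B2.
  by move=> Xx Yy; have [] := mean_vector_bounds cX cY Gx_meas Gy_meas B1_gt0 B2_gt0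
    Gx_exp Gy_exp Xx Yy.
have sxE : step_x p = m * r ^+ 2 / (40 * A * B1 ^+ 2).
  have -> : step_x p = r ^+ 2 * (m / (40 * A * B1 ^+ 2)).
    by apply: step_x_params => /=; rewrite [RHS]mulrCA [RHS]mulrA.
  by rewrite [LHS]mulrCA [LHS]mulrA.
have syE : step_y p = m * r ^+ 2 / (40 * A * B2 ^+ 2).
  have -> : step_y p = r ^+ 2 * (m / (40 * A * B2 ^+ 2)).
    by apply: step_y_params => /=; rewrite [RHS]mulrCA [RHS]mulrA.
  by rewrite [LHS]mulrCA [LHS]mulrA.
have := epoch_gap_le cX vX cY vY m_gt0 m_mu m_lambda f_sconvex f_sconcave G_unbiased
  B1_gt0 B2_gt0 mean_x mean_y r0 (nb_gt0 k) (Xz w) (Yz w) A_gt0 th0 sxE syE budget small gk.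
rewrite /good /=; congr (_ <= _%:E)%E.
by rewrite exprMn exprVn sqr_sqrtr // -/params -/p -/r; field.
Qed.

Lemma epochs_success k : ((1 - k%:R * dt)%:E <= P (good k))%E.
Proof.
have mg j : measurable (good j) by exact: measurable_epoch_gap.
suff : (P (~` good k) <= (k%:R * dt)%:E)%E.
  rewrite probability_setC //.
  have PA : P (good k) \is a fin_num by exact: fin_num_measure.
  by rewrite -(fineK PA) -EFinB !lee_fin; lra.
elim: k => [|k IH].
  rewrite (_ : ~` good 0 = set0) ?measure0 ?mul0r //.
  by apply/seteqP; split => // w; apply; exact: gap0.
have [F [mF PF] sub] := epoch_failure k.
apply: (@le_trans _ _ (P (~` good k `|` F))).
  by apply: le_measure => //; rewrite inE; [exact: measurableC|
    apply: measurableU => //; exact: measurableC].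
apply: (le_trans (measureU2 _ _ _)) => //; first exact: measurableC.
by rewrite -natr1 mulrDl mul1r EFinD leeD.
Qed.

End Epochs.

(** The last epoch guarantees [m R1^2 / (8 * 2^K)], which grows with [R1]: it yields [eps] at the
    smallest admissible [R1], and in general [eps] times [m R1^2 / (8 eps0)]. Likewise an epoch
    length above [T1_min] adds its excess to the count. *)
Theorem theorem1 (R : realType) (d n : nat)
  (X : set 'rV[R]_d) (Y : set 'rV[R]_n)
  (f : 'rV[R]_d -> 'rV[R]_n -> R) (mu lambda : R)
  (X_closed : closed X) (X_convex : convex_set X)
  (Y_closed : closed Y) (Y_convex : convex_set Y)
  (f_cont : {within X `*` Y, continuous (fun z => f z.1 z.2)})
  (mu_gt0 : 0 < mu) (lambda_gt0 : 0 < lambda)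
  (f_sconvex : forall y, Y y -> strongly_convex mu X (f^~ y))
  (f_sconcave : forall x, X x -> strongly_concave lambda Y (f x))
  (* stochastic oracle *)
  (dXi : measure_display) (Xi : measurableType dXi) (D : probability Xi R)
  (Gx : 'rV[R]_d -> 'rV[R]_n -> Xi -> 'rV[R]_d)
  (Gy : 'rV[R]_d -> 'rV[R]_n -> Xi -> 'rV[R]_n)
  (Gx_meas : measurable_oracle X Y Gx) (Gy_meas : measurable_oracle X Y Gy)
  (G_unbiased : unbiased_oracle D X Y f Gx Gy)
  (B1 B2 : R) (B1_gt0 : 0 < B1) (B2_gt0 : 0 < B2)
  (Gx_exp : exp_moment_bound D X Y Gx B1)
  (Gy_exp : exp_moment_bound D X Y Gy B2)
  (* samples used by the algorithm *)
  (dO : measure_display) (Omega : measurableType dO) (P : probability Omega R)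
  (xi : nat -> nat -> {RV P >-> Xi}) (xi_fresh : fresh_samples D xi)
  (* initial solutions and accuracy *)
  (x0 : 'rV[R]_d) (y0 : 'rV[R]_n) (X_x0 : X x0) (Y_y0 : Y y0)
  (eps0 : R) (eps0_gt0 : 0 < eps0)
  (gap0 : (gap X Y f x0 y0 <= eps0%:E)%E)
  (delta eps : R) (delta01 : 0 < delta < 1) (eps01 : 0 < eps < 1)
  (* parameters *)
  (K : nat) (K_def : K%:Z = Num.ceil (ln (eps0 / eps) / ln 2))
  (dt : R) (dt_def : dt = delta / K%:R)
  (m : R) (m_def : m = Num.min mu lambda)
  (R1 : R) (R1_ge : 2 * Num.sqrt (2 * eps0 / m) <= R1)
  (etax1 etay1 : R)
  (etax1_def : etax1 = m * R1 ^+ 2 / (40 * (5 + 3 * ln (1 / dt)) * B1 ^+ 2))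
  (etay1_def : etay1 = m * R1 ^+ 2 / (40 * (5 + 3 * ln (1 / dt)) * B2 ^+ 2))
  (T1 : nat)
  (T1_ge : iteration_constant B1 B2 dt / (m ^+ 2 * R1 ^+ 2) <= T1%:R) :
  let p1 := EpochParams etax1 etay1 R1 T1 in
  let out w := epoch_gda X Y Gx Gy p1 (x0, y0) (fun k t => xi k t w) K in
  let T1_min := iteration_constant B1 B2 dt / (m ^+ 2 * R1 ^+ 2) in
  let Ttot := iteration_constant B1 B2 dt / (4 * m * eps) in
  [/\ (R1 = 2 * Num.sqrt (2 * eps0 / m) ->
        ((1 - delta)%:E <=
          P [set w | gap X Y f (out w).1 (out w).2 <= eps%:E])%E),
      ((1 - delta)%:E <=
          P [set w | gap X Y f (out w).1 (out w).2 <=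
                     (m * R1 ^+ 2 / (8 * eps0) * eps)%:E])%E
    & (total_iterations p1 K)%:R
        <= Ttot + (T1%:R - T1_min) * (2 ^+ K - 1)].
Proof.
move=> p1 out T1_min Ttot.
have m_gt0 : 0 < m by rewrite m_def lt_min mu_gt0.
have m_mu : m <= mu by rewrite m_def ge_min lexx.
have m_lambda : m <= lambda by rewrite m_def ge_min lexx orbT.
have [/andP[d0 d1] /andP[e0 e1]] := (delta01, eps01).
have ratio_gt0 : 0 < eps0 / eps by rewrite divr_gt0.
have [K_ge K_lt] := andP (ceil_log2_bounds ratio_gt0 K_def).
have q0 : 0 < 2 * eps0 / m by rewrite divr_gt0 // mulr_gt0.
have sq0 : 0 < 2 * Num.sqrt (2 * eps0 / m) by rewrite mulr_gt0 // sqrtr_gt0.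
have R1_gt0 : 0 < R1 := lt_le_trans sq0 R1_ge.
have mR1 : 8 * eps0 <= m * R1 ^+ 2.
  have : (2 * Num.sqrt (2 * eps0 / m)) ^+ 2 <= R1 ^+ 2.
    by rewrite lerXn2r ?nnegrE ?(ltW sq0) ?(ltW R1_gt0).
  rewrite exprMn sqr_sqrtr ?(ltW q0) // => /(ler_wpM2l (ltW m_gt0)).
  by apply: le_trans; rewrite le_eqVlt; apply/orP; left; apply/eqP; field; rewrite gt_eqF.
have target : m * radius (iter K (@next_params R) p1) ^+ 2 / 8 <=
    m * R1 ^+ 2 / (8 * eps0) * eps.
  rewrite radius_params /=.
  have -> : m * R1 ^+ 2 / (8 * eps0) * eps = m * R1 ^+ 2 / 8 * (eps0 / eps)^-1.
    by field; rewrite !gt_eqF.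
  have -> : m * (R1 ^+ 2 / 2 ^+ K) / 8 = m * R1 ^+ 2 / 8 * (2 ^+ K)^-1.
    by field; rewrite expf_neq0.
  apply: ler_wpM2l; first by rewrite divr_ge0 // mulr_ge0 ?sqr_ge0 // ltW.
  by rewrite lef_pV2 ?posrE // exprn_gt0.
have X0 : X !=set0 by exists x0.
have Y0 : Y !=set0 by exists y0.
have gap0' : (gap X Y f x0 y0 <= (m * R1 ^+ 2 / 8)%:E)%E.
  by apply: (le_trans gap0); rewrite lee_fin ler_pdivlMr // mulrC.
have main : ((1 - delta)%:E <= P [set w | (gap X Y f (out w).1 (out w).2 <=
    (m * R1 ^+ 2 / (8 * eps0) * eps)%:E)%E])%E.
  (* With [K = 0] there is no epoch and [dt = delta / 0 = 0], outside the range of [epochs_success];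
     the output is then the initial pair, whose gap is already small enough. *)
  have [K0|K_gt0] := posnP K.
    rewrite (_ : [set w | _] = setT).
      by rewrite (_ : P setT = 1%E) ?lee_fin ?gerBl ?(ltW d0) //; exact: probability_setT.
    apply/seteqP; split => // w _ /=; rewrite /out K0 /=; apply: (le_trans gap0').
    by move: target; rewrite K0 lee_fin.
  have Kr : 0 < K%:R :> R by rewrite ltr0n.
  have dt01 : 0 < dt < 1.
    rewrite dt_def divr_gt0 //= ltr_pdivrMr // mul1r (lt_le_trans d1) //.
    by rewrite ler1n.
  have Kdt : K%:R * dt = delta by rewrite dt_def mulrC divfK // gt_eqF.
  have p1E : p1 = EpochParams (m * R1 ^+ 2 / (40 * (5 + 3 * ln (1 / dt)) * B1 ^+ 2))
      (m * R1 ^+ 2 / (40 * (5 + 3 * ln (1 / dt)) * B2 ^+ 2)) R1 T1.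
    by rewrite /p1 etax1_def etay1_def.
  have := epochs_success X_closed X_convex Y_closed Y_convex f_cont m_gt0 m_mu m_lambda
    f_sconvex f_sconcave Gx_meas Gy_meas G_unbiased B1_gt0 B2_gt0 Gx_exp Gy_exp xi_fresh
    X_x0 Y_y0 dt01 R1_gt0 T1_ge gap0' K.
  rewrite -p1E Kdt => /le_trans; apply.
  have mE := measurable_epoch_gap D X_closed X_convex Y_closed Y_convex f_cont m_gt0
    Gx_meas Gy_meas B1_gt0 xi X_x0 Y_y0 dt01 R1_gt0 T1_ge K.
  rewrite -p1E in mE.
  apply: le_measure; rewrite ?inE; [exact: mE|exact: mE|].
  by move=> w /= /le_trans; apply; rewrite lee_fin.
split => //.
- move=> R1E; move: main; congr (_ <= P _)%E; apply/funext => w /=.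
  congr (_ <= _%:E)%E; rewrite R1E exprMn sqr_sqrtr ?(ltW q0) //.
  by field; rewrite !gt_eqF.
- have ln_ge0 : 0 <= ln (1 / dt).
    (* For [K = 0] the conventions [1 / 0 = 0] and [ln 0 = 0] apply. *)
    have [K0|K_gt0] := posnP K.
      by rewrite dt_def K0 invr0 mulr0 invr0 mulr0 ln0.
    have Kr : 0 < K%:R :> R by rewrite ltr0n.
    rewrite ln_ge0 // div1r dt_def invf_ge1 ?divr_gt0 // ler_pdivrMr // mul1r.
    by rewrite (le_trans (ltW d1)) // ler1n.
  have C0 : 0 <= iteration_constant B1 B2 dt.
    rewrite /iteration_constant le_max; apply/orP; left.
    apply: mulr_ge0; first by apply: mulr_ge0; exact: sqr_ge0.
    by rewrite mulr_ge0.
  suff h : T1_min * (2 ^+ K - 1) <= Ttot.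
    by rewrite total_iterationsE /= mulrBl; move: h; lra.
  rewrite /T1_min /Ttot; set C := iteration_constant _ _ _ in C0 *.
  have E : C / (4 * m * eps) - C / (m ^+ 2 * R1 ^+ 2) * (2 ^+ K - 1) =
      C / (m * (m * R1 ^+ 2)) * (m * R1 ^+ 2 / (4 * eps) - (2 ^+ K - 1)).
    by field; rewrite !gt_eqF.
  rewrite -subr_ge0 E; apply: mulr_ge0.
    by rewrite divr_ge0 // mulr_ge0 ?(ltW m_gt0) // mulr_ge0 ?sqr_ge0 ?(ltW m_gt0).
  (* Combined with [2 ^+ K < 2 * (eps0 / eps)], this makes the second factor of [E] positive; the
     constant 4 in [Ttot] is [8 / 2], from [8 * eps0 <= m * R1 ^+ 2] and the rounding of [K]. *)
  have : 2 * (eps0 / eps) <= m * R1 ^+ 2 / (4 * eps).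
    have -> : 2 * (eps0 / eps) = 8 * eps0 / (4 * eps) by field; rewrite gt_eqF.
    by rewrite ler_pM2r // invr_gt0 mulr_gt0.
  by move: K_lt; lra.
Qed.
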